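(* Let $h:\mathbb{R}\to\mathbb{R}$ satisfy Assumptions 1 and 2 (stated in the context), with minimiser $x^\star$, functions $m$, $\alpha$ and constant $A$. Let $r,\delta,d$ be arbitrary positive numbers such that $r-d-2\delta>0$ and $\underline{\delta}^\star(\delta)\ge A+\bar b$ for some $\bar b>0$. Let $r_0:=\chi(r-d-2\delta)$. Then there exist $\bar t=\bar t(r_0,d)$ and $\gamma^\star=\gamma^\star(M_r,L_r,\delta,d)>0$ such that for any $\gamma\in(0,\gamma^\star)$ and any $x_0\in\mathbb{R}$ with $|x_0-x^\star|\le r_0$, the trajectories of $$\dot x=-\gamma\,h\bigl(x+\delta u(t)\bigr)\,u(t),\qquad x(0)=x_0,\qquad u(t)=\sin(2\pi t),$$ are bounded and $$|x(t)|_{\mathcal{A}_\delta}\le d\qquad\text{for all } t\ge\frac{\bar t}{\gamma}.$$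
   Context: Assumption 1: the function $h$ is smooth and there exists $x^\star\in\mathbb{R}$ such that $h(x)-h(x^\star)>0$ for all $x\in\mathbb{R}$ with $x\neq x^\star$. Assumption 2: there exist a locally Lipschitz and strictly quasi-convex function $m:\mathbb{R}\to\mathbb{R}$, a class-$\mathcal{K}_\infty$ function $\alpha$, and a constant $A\ge 0$ such that (1) $m(x)-A\le h(x)\le m(x)+A$ for all $x\in\mathbb{R}$; (2) for all $x_1,x_2\in\mathbb{R}$ with $(x_1-x^\star)(x_2-x^\star)\ge 0$, one has $|m(x_2)-m(x_1)|\ge\alpha(|x_2-x_1|)$. (Strictly quasi-convex: $m(x)<m(y)$ implies $m(\theta x+(1-\theta)y)<m(y)$ for all $\theta\in(0,1)$.) The function $\underline{\delta}^\star$ is $\underline{\delta}^\star(s):=2\int_0^{1/2}\alpha\bigl(s\sin(2\pi t)\bigr)\,dt$. The average system is $\dot x_a=-\frac{\gamma}{2}b_{1,\delta}(x_a)$ with $b_{1,\delta}(x):=2\int_0^1 h(x+\delta\sin(2\pi t))\sin(2\pi t)\,dt$. The set $\mathcal{A}_\delta\subseteq[x^\star-\delta,x^\star+\delta]$ is a compact set that is globally asymptotically and locally exponentially stable for the average system (such a set exists under the stated conditions on $\delta$ and $A$). $|\cdot|_{\mathcal{A}_\delta}$ denotes the distance to $\mathcal{A}_\delta$. The function $\beta$ is a class-$\mathcal{KL}$ function such that all solutions of the average system satisfy $|x_a(t)|_{\mathcal{A}_\delta}\le\beta(|x_a(0)|_{\mathcal{A}_\delta},\gamma t)$ for all $t\ge0$,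 and $\chi(s):=\beta^{-1}(s,0)$ is the class-$\mathcal{K}_\infty$ function that is the inverse of $s\mapsto\beta(s,0)$ (which is taken of class $\mathcal{K}_\infty$). For $r>0$, $L_r>0$ and $M_r>0$ denote a Lipschitz constant and an upper bound of $h$ on $[x^\star-r,x^\star+r]$: $|h(x_1)-h(x_2)|\le L_r|x_1-x_2|$ and $|h(x)|\le M_r$ for all $x,x_1,x_2\in[x^\star-r,x^\star+r]$. The arguments displayed in $\bar t(\cdot)$ and $\gamma^\star(\cdot)$ list the quantities on which these numbers depend, besides the average system and its stability estimates. *)

(* Defs.v *)
From Stdlib Require Import Reals.
From Coquelicot Require Import Coquelicot.
Open Scope R_scope.

(* Functions on [0, +oo) are represented by functions R -> R whose values at
   negative arguments are irrelevant. *)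

Definition class_K (f : R -> R) : Prop :=
  f 0 = 0 /\
  (forall s1 s2, 0 <= s1 -> s1 < s2 -> f s1 < f s2) /\
  (forall s, 0 <= s -> continue_in f (fun y => 0 <= y) s).

Definition class_Kinfty (f : R -> R) : Prop :=
  class_K f /\ is_lim f p_infty p_infty.

Definition class_KL (beta : R -> R -> R) : Prop :=
  (forall t, 0 <= t -> class_K (fun s => beta s t)) /\
  (forall s, 0 <= s ->
     (forall t1 t2, 0 <= t1 -> t1 <= t2 -> beta s t2 <= beta s t1) /\
     is_lim (beta s) p_infty 0).

Definition inverse_on_nonneg (f g : R -> R) : Prop :=
  forall s, 0 <= s -> 0 <= g s /\ f (g s) = s /\ g (f s) = s.

Definition smooth (f : R -> R) : Prop :=
  forall (n : nat) (x : R), ex_derive_n f n x.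

Definition locally_Lipschitz (f : R -> R) : Prop :=
  forall x, exists eps L, 0 < eps /\
    forall y z, Rabs (y - x) < eps -> Rabs (z - x) < eps ->
      Rabs (f y - f z) <= L * Rabs (y - z).

Definition strictly_quasi_convex (f : R -> R) : Prop :=
  forall x y theta, f x < f y -> 0 < theta < 1 ->
    f (theta * x + (1 - theta) * y) < f y.

Definition assumption1 (h : R -> R) (xstar : R) : Prop :=
  smooth h /\ forall x, x <> xstar -> h x - h xstar > 0.

Definition assumption2 (h : R -> R) (xstar : R)
    (m alpha : R -> R) (A : R) : Prop :=
  locally_Lipschitz m /\ strictly_quasi_convex m /\
  class_Kinfty alpha /\ 0 <= A /\
  (forall x, m x - A <= h x <= m x + A) /\
  (forall x1 x2, (x1 - xstar) * (x2 - xstar) >= 0 ->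
     Rabs (m x2 - m x1) >= alpha (Rabs (x2 - x1))).

Definition delta_lower (alpha : R -> R) (s : R) : R :=
  2 * RInt (fun t => alpha (s * sin (2 * PI * t))) 0 (1 / 2).

Definition dither (t : R) : R := sin (2 * PI * t).

Definition b1 (h : R -> R) (delta x : R) : R :=
  2 * RInt (fun t => h (x + delta * sin (2 * PI * t)) * sin (2 * PI * t)) 0 1.

(* Solution of x' = F t x on [0, +oo); [D_in] is the derivative relative to
   [0, +oo), hence the right derivative at t = 0. *)
Definition solution (F : R -> R -> R) (x : R -> R) : Prop :=
  forall t, 0 <= t -> D_in x (fun s => F s (x s)) (fun s => 0 <= s) t.

Definition dither_field (h : R -> R) (delta gamma t x : R) : R :=
  - gamma * h (x + delta * dither t) * dither t.

Definition average_field (b : R -> R) (gamma t x : R) : R :=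
  - (gamma / 2) * b x.

(* The infimum is finite when S is nonempty. *)
Definition dist_set (S : R -> Prop) (x : R) : R :=
  real (Glb_Rbar (fun y => exists a, S a /\ y = Rabs (x - a))).

(* Forward completeness, Lyapunov stability and global attractivity of S. *)
Definition globally_asymptotically_stable
    (F : R -> R -> R) (S : R -> Prop) : Prop :=
  (forall x0, exists x, x 0 = x0 /\ solution F x) /\
  (forall eps, 0 < eps -> exists eta, 0 < eta /\
     forall x, solution F x -> dist_set S (x 0) <= eta ->
       forall t, 0 <= t -> dist_set S (x t) <= eps) /\
  (forall x, solution F x -> is_lim (fun t => dist_set S (x t)) p_infty 0).

Definition locally_exponentially_stable
    (F : R -> R -> R) (S : R -> Prop) : Prop :=
  exists rho k lambda, 0 < rho /\ 0 < k /\ 0 < lambda /\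
    forall x, solution F x -> dist_set S (x 0) <= rho ->
      forall t, 0 <= t ->
        dist_set S (x t) <= k * exp (- lambda * t) * dist_set S (x 0).

(* Main.v *)
Require Import Defs.
From Stdlib Require Import Reals Ranalysis5 Lra Lia ClassicalEpsilon.
From Coquelicot Require Import Coquelicot.
Open Scope R_scope.

(** No general averaging theorem is needed, because the state is scalar.

    Assumption 2 makes [m] grow at least like [alpha] on both sides of the minimiser, so the
    averaged drift [b] is bounded away from [0], with the sign pointing inwards, outside
    [[xstar - delta, xstar + delta]].  Its zeros are equilibria and hence lie in the attractor;
    stability excludes gaps in the attractor, whose closure is therefore an interval [[a1, a2]].
    It follows that [b >= c] on [[a2 + d, +oo)] and [b <= - c] on [(-oo, a1 - d]] for some
    [c > 0] depending only on [b], the attractor and [d].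

    Over one period of the dither the state moves by [- gamma / 2 * b x] up to an error
    [gamma ^ 2 * L * M].  For small [gamma] the state sampled at integer times therefore moves
    inwards by at least a multiple of [gamma * c] per period, until it reaches the
    [d]-neighbourhood of the interval, which it cannot leave. *)

(** * Distance to a set and scalar crossing arguments *)

(** Two obstacles lie beside the averaging estimate. The bounds on [h] hold only on
    [[xstar - r, xstar + r]], yet solutions must exist for all times. Picard iteration is therefore
    run with the state clipped to distance [r - delta] from [xstar], and the bound that confines
    trajectories to this tube removes the clip afterwards. That bound looks circular, as the speed
    is known to be at most [gamma * M] only inside the tube; a first-exit argument, renewed at each
    period with a margin [d / 4], breaks the circle.

    The hypothesis on [delta] concerns the plain mean of [alpha (delta * sin)], whereas the averaged
    drift weights the same quantity by the sine; an association inequality passes from one to the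
    other.

    The radius [d] is spent in three portions: the drift is bounded below beyond [d / 2], a sample
    inside that zone can leave it by less than [d / 4] in one period, and the motion between samples
    takes the last [d / 4]. *)

Section Distance.

Variable S : R -> Prop.
Hypothesis S_nonempty : exists a, S a.

(** Nonemptiness places the infimum between 0 and one actual distance; an infinite value would be
    turned into 0 by [real]. *)
Lemma dist_set_is_glb x :
  is_glb_Rbar (fun y => exists a, S a /\ y = Rabs (x - a)) (dist_set S x).
Proof.
unfold dist_set.
assert (H := Glb_Rbar_correct (fun y => exists a, S a /\ y = Rabs (x - a))).
destruct S_nonempty as [a Sa].
assert (Hle : Rbar_le (Glb_Rbar (fun y => exists a, S a /\ y = Rabs (x - a)))
                      (Rabs (x - a))) by (apply H; eauto).
assert (Hge : Rbar_le 0 (Glb_Rbar (fun y => exists a, S a /\ y = Rabs (x - a)))).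
{ apply H; intros y [a' [_ ->]]; apply Rabs_pos. }
destruct (Glb_Rbar _) as [l| |]; try easy.
Qed.

Lemma dist_set_le x a : S a -> dist_set S x <= Rabs (x - a).
Proof. intros Sa; apply (dist_set_is_glb x); eauto. Qed.

Lemma dist_set_lower_bound x l :
  (forall a, S a -> l <= Rabs (x - a)) -> l <= dist_set S x.
Proof.
intros H; apply (proj2 (dist_set_is_glb x) l).
intros y [a [Sa ->]]; apply H, Sa.
Qed.

Lemma dist_set_pos x : 0 <= dist_set S x.
Proof. apply dist_set_lower_bound; intros; apply Rabs_pos. Qed.

Lemma dist_set_triangle x y : dist_set S x <= dist_set S y + Rabs (x - y).
Proof.
enough (dist_set S x - Rabs (x - y) <= dist_set S y) by lra.
apply dist_set_lower_bound; intros a Sa.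
assert (H := dist_set_le x a Sa).
assert (T := Rabs_triang (x - y) (y - a)).
replace (x - y + (y - a)) with (x - a) in T by ring; lra.
Qed.

End Distance.

(** The hitting time is the supremum of the times up to which [g] has stayed below [v]; continuity
    excludes both [g t > v] and [g t < v] there. The bound on all earlier times is what first-exit
    arguments use. *)
Lemma first_hit (g : R -> R) a b v :
  (forall t, continuous g t) -> a <= b -> g a < v -> v <= g b ->
  exists t, a < t <= b /\ g t = v /\ forall s, a <= s < t -> g s < v.
Proof.
intros Cg Hab Ha Hb.
pose (E := fun t => a <= t <= b /\ forall s, a <= s <= t -> g s < v).
assert (bE : bound E) by (exists b; intros t [Ht _]; lra).
assert (nE : exists t, E t).
{ exists a; split; [lra|]; intros s Hs; replace s with a by lra; exact Ha. }
destruct (completeness E bE nE) as [t [ub lub]].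
assert (Hat : a <= t).
{ apply ub; split; [lra|]; intros s Hs; replace s with a by lra; exact Ha. }
assert (Htb : t <= b) by (apply lub; intros s [Hs _]; lra).
assert (below : forall s, a <= s < t -> g s < v).
{ intros s Hs; apply Rnot_le_lt; intros Hv.
  enough (t <= s) by lra.
  apply lub; intros w [Hw Hw']; apply Rnot_lt_le; intros Hsw.
  specialize (Hw' s); lra. }
assert (Hloc : forall eps, 0 < eps -> exists eta, 0 < eta /\
          forall s, Rabs (s - t) < eta -> Rabs (g s - g t) < eps).
{ intros eps Heps.
  destruct (proj1 (filterlim_locally g (g t)) (Cg t) (mkposreal eps Heps))
    as [eta Heta].
  exists eta; split; [apply cond_pos|]; intros s Hs; apply Heta, Hs. }
assert (le : g t <= v).
{ apply Rnot_lt_le; intros Hlt.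
  destruct (Hloc (g t - v)) as [eta [Heta H]]; [lra|].
  assert (t <> a) by (intros ->; lra).
  pose (s := Rmax a (t - eta / 2)).
  assert (a <= s < t /\ Rabs (s - t) < eta) as [Hs Hs'].
  { unfold s; unfold Rmax; destruct (Rle_dec _ _); split; try lra;
      apply Rabs_def1; lra. }
  specialize (H s Hs'); apply Rabs_def2 in H; specialize (below s Hs); lra. }
assert (ge : v <= g t).
{ apply Rnot_lt_le; intros Hlt.
  destruct (Hloc (v - g t)) as [eta [Heta H]]; [lra|].
  assert (t <> b) by (intros ->; lra).
  pose (s := Rmin b (t + eta / 2)).
  assert (t < s <= b /\ s < t + eta) as [Hs Hs'].
  { unfold s; unfold Rmin; destruct (Rle_dec _ _); split; lra. }
  enough (s <= t) by lra.
  apply ub; split; [lra|]; intros w Hw.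
  destruct (Rlt_le_dec w t) as [Hwt|Hwt]; [apply below; lra|].
  assert (Hw2 : Rabs (w - t) < eta) by (apply Rabs_def1; lra).
  specialize (H w Hw2); apply Rabs_def2 in H; lra. }
exists t; split; [split|split; [lra|exact below]]; try lra.
assert (t <> a) by (intros ->; lra); lra.
Qed.

Lemma continuous_IVT (g : R -> R) a b v :
  (forall t, continuous g t) -> a <= b -> g a < v -> v <= g b ->
  exists t, a < t <= b /\ g t = v.
Proof.
intros Cg Hab Ha Hb; destruct (first_hit g a b v Cg Hab Ha Hb) as (t & ? & ? & _).
eauto.
Qed.

Lemma is_derive_continuous (g : R -> R) t l : is_derive g t l -> continuous g t.
Proof. intros H; apply (ex_derive_continuous g); exists l; exact H. Qed.

(** The derivative is asked for only inside the interval because a solution has a mere one-sided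
    derivative at time 0. *)
Lemma mean_value_bound (g : R -> R) a b K :
  (forall t, continuous g t) -> a <= b ->
  (forall t, a < t < b -> exists l, is_derive g t l /\ Rabs l <= K) ->
  Rabs (g b - g a) <= K * (b - a).
Proof.
intros Cg Hab Hd.
destruct Hab as [Hab| ->]; [|rewrite !Rminus_eq_0, Rabs_R0; lra].
assert (pr : forall c, a < c < b -> derivable_pt g c).
{ intros c Hc; apply ex_derive_Reals_0.
  destruct (Hd c Hc) as (l & Hl & _); exists l; exact Hl. }
destruct (MVT g id a b pr (fun c _ => derivable_pt_id c)) as (c & Hc & E).
- exact Hab.
- intros c _; apply continuity_pt_filterlim, Cg.
- intros c _; apply derivable_continuous_pt, derivable_pt_id.
- destruct (Hd c Hc) as (l & Hl & Hb).
  rewrite derive_pt_id in E.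
  rewrite (derive_pt_eq_0 g c l (pr c Hc)) in E by apply is_derive_Reals, Hl.
  unfold id in E; replace (g b - g a) with ((b - a) * l) by lra.
  rewrite Rabs_mult, Rabs_pos_eq by lra; nra.
Qed.

(* Past the last time at which [y = v], [y] would be below [v], yet its slope is positive there. *)
Lemma barrier (y dy : R -> R) v :
  (forall t, continuous y t) ->
  (forall t, 0 < t -> is_derive y t (dy t)) ->
  v < y 0 -> (forall t, 0 < t -> y t = v -> 0 < dy t) ->
  forall t, 0 <= t -> v <= y t.
Proof.
intros Cy Hd H0 Hv t Ht; apply Rnot_lt_le; intros Hlt.
(* Time reversal turns the first hit into the last time before [t] at which [y = v]. *)
destruct (first_hit (fun s => y (t - s)) 0 t v) as (s & Hs & E & Hbelow).
- intros s. apply (continuous_comp (fun s => t - s) y); [|apply Cy].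
  apply (continuous_minus (fun _ => t) (fun s => s));
    [apply continuous_const|apply continuous_id].
- lra.
- rewrite Rminus_0_r; lra.
- rewrite Rminus_eq_0; lra.
- set (u := t - s) in *.
  assert (Hu : 0 < u).
  { destruct (Req_dec s t) as [->|]; [|unfold u; lra].
    unfold u in E; rewrite Rminus_eq_0 in E; lra. }
  assert (Hpos := Hv u Hu E).
  assert (Hder := proj1 (is_derive_Reals _ _ _) (Hd u Hu)).
  destruct (Hder (dy u) Hpos) as [eta Heta].
  assert (He := cond_pos eta).
  pose (k := Rmin s (eta / 2)).
  assert (Hk : 0 < k <= s /\ k < eta).
  { unfold k, Rmin; destruct (Rle_dec _ _); lra. }
  specialize (Heta k); rewrite (Rabs_pos_eq k) in Heta by lra.
  specialize (Heta ltac:(lra) ltac:(lra)).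
  apply Rabs_def2 in Heta.
  assert (Hq : 0 < (y (u + k) - y u) / k) by lra.
  specialize (Hbelow (s - k) ltac:(lra)); cbv beta in Hbelow.
  replace (t - (s - k)) with (u + k) in Hbelow by (unfold u; ring).
  assert (y (u + k) - y u < 0) by lra.
  assert ((y (u + k) - y u) / k < 0).
  { apply Rdiv_neg_pos; lra. }
  lra.
Qed.

(** The speed bound is available only within [rho] of [y a]. Up to the first time at deviation [rho]
    it does apply, and gives a deviation of at most [K * (b - a) < rho], so that time does not
    exist. *)
Lemma escape_bound (y : R -> R) a b K rho :
  (forall t, continuous y t) -> a <= b -> 0 <= K -> K * (b - a) < rho ->
  (forall t, a < t < b -> Rabs (y t - y a) <= rho ->
     exists l, is_derive y t l /\ Rabs l <= K) ->
  forall t, a <= t <= b -> Rabs (y t - y a) <= K * (t - a).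
Proof.
intros Cy Hab HK HKr Hd.
assert (Hin : forall t, a <= t <= b -> Rabs (y t - y a) < rho).
{ intros t Ht; apply Rnot_le_lt; intros Hle.
  destruct (first_hit (fun s => Rabs (y s - y a)) a t rho) as (s & Hs & E & Hb).
  - intros s; apply (continuous_comp (fun s => y s - y a) Rabs).
    + apply (continuous_minus y (fun _ => y a)); [apply Cy|apply continuous_const].
    + apply continuous_Rabs.
  - lra.
  - rewrite Rminus_eq_0, Rabs_R0; nra.
  - exact Hle.
  - cbv beta in *.
    assert (Rabs (y s - y a) <= K * (s - a)).
    { apply mean_value_bound; [exact Cy|lra|].
      intros w Hw; apply Hd; [lra|]; left; apply Hb; lra. }
    nra. }
intros t Ht; apply mean_value_bound; [exact Cy|lra|].
intros w Hw; apply Hd; [lra|]; left; apply Hin; lra.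
Qed.

(** * Solutions of globally Lipschitz equations *)

Lemma Lipschitz_continuous (f : R -> R) K :
  0 <= K -> (forall x y, Rabs (f x - f y) <= K * Rabs (x - y)) ->
  forall x, continuous f x.
Proof.
intros HK Hf x; apply filterlim_locally; intros eps.
assert (He := cond_pos eps).
assert (0 < eps / (K + 1)) by (apply Rdiv_lt_0_compat; lra).
exists (mkposreal (eps / (K + 1)) H); intros y Hy.
change (Rabs (y - x) < eps / (K + 1)) in Hy; change (Rabs (f y - f x) < eps).
specialize (Hf y x).
assert (Rabs (y - x) * (K + 1) < eps).
{ apply Rlt_le_trans with (eps / (K + 1) * (K + 1)); [nra|].
  right; field; lra. }
assert (P := Rabs_pos (y - x)); nra.
Qed.

Lemma continuous_ex_RInt (f : R -> R) a b :
  (forall t, continuous f t) -> ex_RInt f a b.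
Proof. intros Cf; apply (ex_RInt_continuous f); intros; apply Cf. Qed.

Lemma is_derive_primitive (f : R -> R) a c t :
  (forall t, continuous f t) -> is_derive (fun t => c + RInt f a t) t (f t).
Proof.
intros Cf.
replace (f t) with (plus 0 (f t)) by apply Rplus_0_l.
apply (is_derive_plus (fun _ => c) (fun t => RInt f a t)).
- apply (is_derive_const (V := R_NormedModule) c t).
- apply (is_derive_RInt f _ a); [|apply Cf].
  apply filter_forall; intros s; apply (RInt_correct f), continuous_ex_RInt, Cf.
Qed.

Lemma geometric_Cauchy (u : nat -> R) K :
  (forall n, Rabs (u (S n) - u n) <= K * (1 / 2) ^ n) ->
  forall n, Rabs (u n - real (Lim_seq u)) <= 2 * K * (1 / 2) ^ n.
Proof.
intros Hu.
assert (Hpow : forall n, 0 < (1 / 2) ^ n) by (intros; apply pow_lt; lra).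
assert (HK : 0 <= K).
{ specialize (Hu 0%nat); simpl in Hu.
  assert (P := Rabs_pos (u 1%nat - u 0%nat)); lra. }
(* Keeping the subtracted tail [(1 / 2) ^ (n + p)] makes the telescoping induction close; the factor
   2 is the sum of the geometric series. *)
assert (Hnp : forall n p,
  Rabs (u (n + p)%nat - u n) <= 2 * K * ((1 / 2) ^ n - (1 / 2) ^ (n + p))).
{ intros n p; induction p as [|p IH].
  - rewrite Nat.add_0_r, !Rminus_eq_0, Rabs_R0; lra.
  - rewrite Nat.add_succ_r; simpl.
    specialize (Hu (n + p)%nat).
    assert (T := Rabs_triang (u (S (n + p)) - u (n + p)%nat) (u (n + p)%nat - u n)).
    replace (u (S (n + p)) - u (n + p)%nat + (u (n + p)%nat - u n))
      with (u (S (n + p)) - u n) in T by ring.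
    lra. }
assert (Hex : ex_finite_lim_seq u).
{ apply ex_lim_seq_cauchy_corr; intros eps.
  assert (He := cond_pos eps).
  destruct (pow_lt_1_zero (1 / 2)) with (y := eps / (4 * K + 1)) as [N HN].
  - rewrite Rabs_pos_eq; lra.
  - apply Rdiv_lt_0_compat; lra.
  - assert (HNeps : forall n, (N <= n)%nat -> Rabs (u n - u N) < eps / 2).
    { intros n Hn; replace n with (N + (n - N))%nat by lia.
      apply Rle_lt_trans with (1 := Hnp N (n - N)%nat).
      specialize (HN N (Nat.le_refl N)).
      rewrite Rabs_pos_eq in HN by (left; apply Hpow).
      apply Rmult_lt_compat_r with (r := 4 * K + 1) in HN; [|lra].
      replace (eps / (4 * K + 1) * (4 * K + 1)) with (pos eps) in HN
        by (field; lra).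
      assert (Q := Hpow (N + (n - N))%nat); assert (Q' := Hpow N); nra. }
    exists N; intros n m Hn Hm.
    assert (A := HNeps n Hn); assert (B := HNeps m Hm).
    apply Rabs_def2 in A; apply Rabs_def2 in B; apply Rabs_def1; lra. }
intros n; apply Lim_seq_correct' in Hex.
assert (Hb : Rbar_le (Rabs (u n - real (Lim_seq u))) (2 * K * (1 / 2) ^ n)).
{ apply is_lim_seq_le with (u := fun p => Rabs (u n - u (p + n)%nat))
    (v := fun _ => 2 * K * (1 / 2) ^ n).
  - intros p; rewrite Rabs_minus_sym, Nat.add_comm.
    apply Rle_trans with (1 := Hnp n p).
    assert (Q := Hpow (n + p)%nat); nra.
  - apply (is_lim_seq_abs _ (Finite _)).
    apply is_lim_seq_minus'; [apply is_lim_seq_const|].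
    apply (is_lim_seq_incr_n u), Hex.
  - apply is_lim_seq_const. }
exact Hb.
Qed.

(** Transfers estimates to the Picard limit through explicit errors, so that no limit has to be
    exchanged with an integral. *)
Lemma le_of_geometric_error a b K :
  (forall n, a <= b + K * (1 / 2) ^ n) -> a <= b.
Proof.
intros H.
replace b with (b + K * 0) by ring.
apply (is_lim_seq_le (fun _ => a) (fun n => b + K * (1 / 2) ^ n) a (b + K * 0) H).
- apply is_lim_seq_const.
-   apply is_lim_seq_plus'; [apply is_lim_seq_const|].
  apply is_lim_seq_mult'; [apply is_lim_seq_const|].
  apply is_lim_seq_geom; rewrite Rabs_pos_eq; lra.
Qed.

Section Picard.

Variables (F : R -> R -> R) (M L x0 : R).
Hypothesis L_pos : 0 < L.
Hypothesis F_continuous : forall X : R -> R, (forall t, continuous X t) ->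
  forall t, continuous (fun s => F s (X s)) t.
Hypothesis F_bounded : forall t x, Rabs (F t x) <= M.
Hypothesis F_Lipschitz : forall t x y, Rabs (F t x - F t y) <= L * Rabs (x - y).

Fixpoint picard_iterate (k : nat) (t : R) : R :=
  match k with
  | O => x0
  | S k => x0 + RInt (fun s => F s (picard_iterate k s)) 0 t
  end.

Lemma picard_iterate_derive k :
  (forall t, continuous (picard_iterate k) t) ->
  forall t, is_derive (picard_iterate (S k)) t (F t (picard_iterate k t)).
Proof.
intros C t; apply (is_derive_primitive (fun s => F s (picard_iterate k s))).
apply F_continuous, C.
Qed.

Lemma picard_iterate_continuous k t : continuous (picard_iterate k) t.
Proof.
revert t; induction k as [|k IH]; intros t.
- apply continuous_const.
- eapply is_derive_continuous, picard_iterate_derive, IH.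
Qed.

Lemma field_along_continuous k t : continuous (fun s => F s (picard_iterate k s)) t.
Proof. apply F_continuous, picard_iterate_continuous. Qed.

Lemma M_nonneg : 0 <= M.
Proof. eapply Rle_trans; [apply Rabs_pos|apply (F_bounded 0 0)]. Qed.

(** The constant [M] is the same for all [k], so it passes to the limit and makes it continuous. *)
Lemma picard_iterate_Lipschitz k s t :
  Rabs (picard_iterate k t - picard_iterate k s) <= M * Rabs (t - s).
Proof.
destruct k as [|k].
- simpl; rewrite Rminus_eq_0, Rabs_R0.
  apply Rmult_le_pos; [apply M_nonneg|apply Rabs_pos].
- apply bounded_variation with (fun t => F t (picard_iterate k t)).
  intros w _; split; [|apply F_bounded].
  apply picard_iterate_derive, picard_iterate_continuous.
Qed.

(* The weight [exp (2 L t)] makes the Picard operator a contraction of ratio 1/2. *)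
Lemma picard_iterate_step k t : 0 <= t ->
  Rabs (picard_iterate (S k) t - picard_iterate k t)
    <= M / (2 * L) * exp (2 * L * t) * (1 / 2) ^ k.
Proof.
assert (HM := M_nonneg).
revert t; induction k as [|k IH]; intros t Ht.
- assert (B := picard_iterate_Lipschitz 1 0 t).
  simpl in B |- *; rewrite RInt_point in B.
  change (zero : R) with 0 in B.
  rewrite Rplus_0_r, Rminus_0_r, (Rabs_pos_eq t) in B by assumption.
  apply Rle_trans with (1 := B).
  assert (E := exp_ineq1_le (2 * L * t)).
  replace (M * t) with (M / (2 * L) * (2 * L * t)) by (field; lra).
  rewrite Rmult_1_r; apply Rmult_le_compat_l; [|lra].
  apply Rdiv_le_0_compat; lra.
- set (c := M / (2 * L) * (1 / 2) ^ S k).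
  assert (Hc : 0 <= c).
  { apply Rmult_le_pos; [apply Rdiv_le_0_compat; lra|apply pow_le; lra]. }
  assert (I1 : is_RInt (fun s => F s (picard_iterate (S k) s) - F s (picard_iterate k s))
                 0 t (picard_iterate (S (S k)) t - picard_iterate (S k) t)).
  { replace (picard_iterate (S (S k)) t - picard_iterate (S k) t) with
     (minus (RInt (fun s => F s (picard_iterate (S k) s)) 0 t)
            (RInt (fun s => F s (picard_iterate k s)) 0 t))
      by (simpl; unfold minus, plus, opp; simpl; ring).
    apply (is_RInt_minus (fun s => F s (picard_iterate (S k) s)));
      apply (RInt_correct (fun s => F s (picard_iterate _ s))), continuous_ex_RInt;
      intros; apply field_along_continuous. }
  assert (I2 : is_RInt (fun s => c * (2 * L) * exp (2 * L * s)) 0 t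
                 (c * exp (2 * L * t) - c * exp (2 * L * 0))).
  { apply (is_RInt_derive (fun s => c * exp (2 * L * s))).
    - intros s _; auto_derive; [easy|ring].
    - intros s _; apply (ex_derive_continuous (fun s => c * (2 * L) * exp (2 * L * s))).
      auto_derive; easy. }
  assert (B : Rabs (picard_iterate (S (S k)) t - picard_iterate (S k) t)
                <= c * exp (2 * L * t) - c * exp (2 * L * 0)).
  { refine (norm_RInt_le _ _ 0 t _ _ Ht _ I1 I2).
    intros s Hs; eapply Rle_trans; [apply F_Lipschitz|].
    apply Rle_trans with (L * (M / (2 * L) * exp (2 * L * s) * (1 / 2) ^ k)).
    + apply Rmult_le_compat_l; [lra|apply IH; lra].
    + right; unfold c; simpl; field; lra. }
  replace (M / (2 * L) * exp (2 * L * t) * (1 / 2) ^ S k) with (c * exp (2 * L * t))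
    by (unfold c; ring).
  assert (P := exp_pos (2 * L * 0)).
  nra.
Qed.

(** Frozen for negative times, where the iterates are not controlled by [picard_iterate_step];
    [F_continuous] asks for a curve continuous on the whole line. *)
Definition picard_limit (t : R) : R :=
  real (Lim_seq (fun k => picard_iterate k (Rmax 0 t))).

Lemma picard_iterate_limit k t : 0 <= t ->
  Rabs (picard_iterate k t - picard_limit t)
    <= 2 * (M / (2 * L) * exp (2 * L * t)) * (1 / 2) ^ k.
Proof.
intros Ht; unfold picard_limit; rewrite Rmax_right by assumption.
apply (geometric_Cauchy (fun k => picard_iterate k t)).
intros n; apply picard_iterate_step, Ht.
Qed.

Lemma picard_limit_Lipschitz s t :
  Rabs (picard_limit s - picard_limit t) <= M * Rabs (s - t).
Proof.
assert (Hclip : forall u, picard_limit u = picard_limit (Rmax 0 u)).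
{ intros u; unfold picard_limit; f_equal; f_equal.
  rewrite (Rmax_right 0 (Rmax 0 u)); [easy|apply Rmax_l]. }
rewrite (Hclip s), (Hclip t).
apply Rle_trans with (M * Rabs (Rmax 0 s - Rmax 0 t)).
- assert (Hs := Rmax_l 0 s); assert (Ht := Rmax_l 0 t).
  set (s' := Rmax 0 s) in *; set (t' := Rmax 0 t) in *.
  apply le_of_geometric_error with
    (2 * (M / (2 * L) * exp (2 * L * s')) + 2 * (M / (2 * L) * exp (2 * L * t'))).
  intros n.
  assert (A := picard_iterate_limit n s' Hs).
  assert (B := picard_iterate_limit n t' Ht).
  assert (C := picard_iterate_Lipschitz n t' s').
  apply Rabs_le_between in A; apply Rabs_le_between in B; apply Rabs_le_between in C.
  apply Rabs_le_between; lra.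
- apply Rmult_le_compat_l; [apply M_nonneg|].
  unfold Rmax; destruct (Rle_dec 0 s), (Rle_dec 0 t); unfold Rabs;
    repeat destruct Rcase_abs; lra.
Qed.

(** The integral of the field along the limit is differentiable by construction, at 0 from both
    sides. For nonnegative times it coincides with the limit, both being geometrically close to the
    iterates. *)
Lemma picard : exists X : R -> R,
  X 0 = x0 /\ forall t, 0 <= t -> is_derive X t (F t (X t)).
Proof.
assert (Cont : forall t, continuous (fun s => F s (picard_limit s)) t).
{ apply F_continuous, Lipschitz_continuous with M; [apply M_nonneg|].
  apply picard_limit_Lipschitz. }
exists (fun t => x0 + RInt (fun s => F s (picard_limit s)) 0 t); split.
- rewrite RInt_point; apply Rplus_0_r.
- intros t Ht.
  replace (x0 + RInt (fun s => F s (picard_limit s)) 0 t) with (picard_limit t).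
  { apply (is_derive_primitive (fun s => F s (picard_limit s))), Cont. }
  set (e := 2 * (M / (2 * L) * exp (2 * L * t))).
  assert (HM := M_nonneg).
  assert (He : Rabs (picard_limit t - (x0 + RInt (fun s => F s (picard_limit s)) 0 t)) <= 0).
  (* [e] bounds the error of iterate [S n], and [t * (L * e)] that of the integral when iterate [n]
     replaces the limit in the field. *)
  { apply le_of_geometric_error with (e + t * (L * e)); intros n.
    assert (Hn := pow_lt (1 / 2) n ltac:(lra)).
    assert (A := picard_iterate_limit (S n) t Ht); fold e in A.
    assert (D : picard_iterate (S n) t - (x0 + RInt (fun s => F s (picard_limit s)) 0 t)
       = RInt (fun s => minus (F s (picard_iterate n s)) (F s (picard_limit s))) 0 t).
    { rewrite (RInt_minus (fun s => F s (picard_iterate n s)) (fun s => F s (picard_limit s))).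
      - simpl; unfold minus, plus, opp; simpl; ring.
      - apply continuous_ex_RInt, field_along_continuous.
      - apply continuous_ex_RInt, Cont. }
    assert (B : Rabs (RInt (fun s => minus (F s (picard_iterate n s)) (F s (picard_limit s))) 0 t)
              <= (t - 0) * (L * (e * (1 / 2) ^ n))).
    { apply abs_RInt_le_const; [exact Ht| |].
      - apply continuous_ex_RInt; intros s.
        apply (continuous_minus (fun s => F s (picard_iterate n s)));
          [apply field_along_continuous|apply Cont].
      - intros s Hs; eapply Rle_trans; [apply F_Lipschitz|].
        apply Rmult_le_compat_l; [lra|].
        apply Rle_trans with (1 := picard_iterate_limit n s (proj1 Hs)).
        apply Rmult_le_compat_r; [lra|]; unfold e.
        apply Rmult_le_compat_l; [lra|].
        apply Rmult_le_compat_l; [apply Rdiv_le_0_compat; lra|].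
        destruct (proj2 Hs) as [Hlt| ->]; [|lra].
        left; apply exp_increasing; nra. }
    rewrite <- D in B.
    assert (0 <= e).
    { unfold e; assert (Q := exp_pos (2 * L * t)).
      apply Rmult_le_pos; [lra|]; apply Rmult_le_pos; [|lra].
      apply Rdiv_le_0_compat; lra. }
    simpl pow in A.
    apply Rabs_le_between in A; apply Rabs_le_between in B; apply Rabs_le_between.
    nra. }
  assert (P := Rabs_pos (picard_limit t - (x0 + RInt (fun s => F s (picard_limit s)) 0 t))).
  apply Rminus_diag_uniq, Rabs_eq_0; lra.
Qed.

End Picard.

Lemma solution_of_derive (F : R -> R -> R) (x : R -> R) :
  (forall t, 0 <= t -> is_derive x t (F t (x t))) -> solution F x.
Proof.
intros H t Ht eps Heps.
assert (D := proj1 (is_derive_Reals _ _ _) (H t Ht)).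
destruct (D eps Heps) as [eta Heta].
exists eta; split; [apply cond_pos|].
intros s [[_ Hs] Hd]; change (Rabs (s - t) < eta) in Hd.
change (Rabs ((x s - x t) / (s - t) - F t (x t)) < eps).
specialize (Heta (s - t) ltac:(lra) Hd).
rewrite Rplus_minus in Heta; exact Heta.
Qed.

Section Solution.

Variables (F : R -> R -> R) (x : R -> R).
Hypothesis x_solution : solution F x.

(** Composition with [Rmax 0] discards the arbitrary values of [x] at negative times, so that lemmas
    about functions on the whole line apply. *)
Lemma solution_derive t : 0 < t -> is_derive (fun t => x (Rmax 0 t)) t (F t (x t)).
Proof.
intros Ht; apply is_derive_Reals; intros eps Heps.
destruct (x_solution t (Rlt_le _ _ Ht) eps Heps) as (eta & Heta & H).
assert (Hm : 0 < Rmin eta t) by (apply Rmin_pos; lra).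
exists (mkposreal _ Hm); intros k Hk0 Hk.
simpl in Hk; assert (A := Rmin_l eta t); assert (B := Rmin_r eta t).
assert (Hk' := Hk); apply Rabs_def2 in Hk'.
rewrite !Rmax_right by lra.
specialize (H (t + k)).
change (D_x (fun s => 0 <= s) t (t + k) /\ Rabs (t + k - t) < eta ->
  Rabs ((x (t + k) - x t) / (t + k - t) - F t (x t)) < eps) in H.
replace (t + k - t) with k in H by ring.
apply H; split; [split; lra|lra].
Qed.

Lemma solution_continuous t : continuous (fun t => x (Rmax 0 t)) t.
Proof.
destruct (Rlt_le_dec 0 t) as [Ht|Ht].
{ eapply is_derive_continuous, solution_derive, Ht. }
apply filterlim_locally; intros eps; assert (He := cond_pos eps).
(* Tolerance 1 in the right derivative at 0 bounds the difference quotients by [K], hence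
   [Rabs (x s - x 0)] by [K * s]. *)
destruct (x_solution 0 (Rle_refl 0) 1 Rlt_0_1) as (eta & Heta & H).
set (K := Rabs (F 0 (x 0)) + 1) in *.
assert (HK : 0 < K) by (assert (P := Rabs_pos (F 0 (x 0))); unfold K; lra).
assert (Hq : 0 < eps / K) by (apply Rdiv_lt_0_compat; lra).
assert (Hm : 0 < Rmin eta (eps / K)) by (apply Rmin_pos; lra).
exists (mkposreal _ Hm); intros s Hs.
change (Rabs (s - t) < Rmin eta (eps / K)) in Hs; apply Rabs_def2 in Hs.
assert (A := Rmin_l eta (eps / K)); assert (B := Rmin_r eta (eps / K)).
change (Rabs (x (Rmax 0 s) - x (Rmax 0 t)) < eps).
rewrite (Rmax_left 0 t) by lra.
destruct (Rle_lt_dec s 0) as [Hs0|Hs0].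
{ rewrite Rmax_left, Rminus_eq_0, Rabs_R0; lra. }
rewrite Rmax_right by lra.
specialize (H s).
change (D_x (fun s => 0 <= s) 0 s /\ Rabs (s - 0) < eta ->
  Rabs ((x s - x 0) / (s - 0) - F 0 (x 0)) < 1) in H.
rewrite Rminus_0_r, (Rabs_pos_eq s) in H by lra.
specialize (H ltac:(split; [split; lra|lra])).
assert (T := Rabs_triang ((x s - x 0) / s - F 0 (x 0)) (F 0 (x 0))).
replace ((x s - x 0) / s - F 0 (x 0) + F 0 (x 0)) with ((x s - x 0) / s) in T by ring.
replace (x s - x 0) with ((x s - x 0) / s * s) by (field; lra).
rewrite Rabs_mult, (Rabs_pos_eq s) by lra.
apply Rle_lt_trans with (K * s); [apply Rmult_le_compat_r; unfold K; lra|].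
apply Rlt_le_trans with (K * (eps / K)); [apply Rmult_lt_compat_l; lra|].
right; field; lra.
Qed.

End Solution.

(** * The averaged drift away from the minimiser *)

Lemma locally_Lipschitz_continuous f x : locally_Lipschitz f -> continuous f x.
Proof.
intros H; destruct (H x) as (r & K & Hr & HK).
apply filterlim_locally; intros eps; assert (He := cond_pos eps).
assert (Hq : 0 < eps / (Rabs K + 1)).
{ apply Rdiv_lt_0_compat; [lra|]; assert (P := Rabs_pos K); lra. }
assert (Hm : 0 < Rmin r (eps / (Rabs K + 1))) by (apply Rmin_pos; lra).
exists (mkposreal _ Hm); intros y Hy.
change (Rabs (y - x) < Rmin r (eps / (Rabs K + 1))) in Hy.
change (Rabs (f y - f x) < eps).
assert (A := Rmin_l r (eps / (Rabs K + 1))); assert (B := Rmin_r r (eps / (Rabs K + 1))).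
assert (C := HK y x ltac:(lra)); rewrite Rminus_eq_0, Rabs_R0 in C; specialize (C Hr).
assert (P := Rabs_pos K); assert (Q := RRle_abs K); assert (S := Rabs_pos (y - x)).
apply Rle_lt_trans with (Rabs (y - x) * (Rabs K + 1)); [nra|].
apply Rlt_le_trans with (eps / (Rabs K + 1) * (Rabs K + 1)); [nra|].
right; field; lra.
Qed.

Lemma class_K_continuous alpha y :
  class_K alpha -> continuous (fun y => alpha (Rmax 0 y)) y.
Proof.
intros (_ & _ & H); apply filterlim_locally; intros eps; assert (He := cond_pos eps).
destruct (H (Rmax 0 y) (Rmax_l 0 y) eps He) as (eta & Heta & Hlim).
exists (mkposreal _ Heta); intros z Hz.
change (Rabs (z - y) < eta) in Hz.
change (Rabs (alpha (Rmax 0 z) - alpha (Rmax 0 y)) < eps).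
destruct (Req_dec (Rmax 0 z) (Rmax 0 y)) as [->|Hne].
{ rewrite Rminus_eq_0, Rabs_R0; lra. }
apply (Hlim (Rmax 0 z)); split; [split; [apply Rmax_l|now apply not_eq_sym]|].
apply Rle_lt_trans with (2 := Hz); change (Rabs (Rmax 0 z - Rmax 0 y) <= Rabs (z - y)).
unfold Rmax; destruct (Rle_dec 0 z), (Rle_dec 0 y); unfold Rabs;
  repeat destruct Rcase_abs; lra.
Qed.

Lemma smooth_continuous h x : smooth h -> continuous h x.
Proof. intros H; apply (ex_derive_continuous h), (H 1%nat x). Qed.

Lemma class_Kinfty_unbounded alpha K :
  class_Kinfty alpha -> exists s0, 0 <= s0 /\ forall s, s0 < s -> K < alpha s.
Proof.
intros (_ & H); apply is_lim_spec in H; destruct (H K) as [N HN].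
exists (Rmax 0 N); split; [apply Rmax_l|].
intros s Hs; apply HN; assert (P := Rmax_r 0 N); lra.
Qed.

(* A continuous injection is monotone, and decrease would contradict boundedness below. *)
Lemma increase_of_growth (g alpha : R -> R) c :
  (forall t, continuous g t) -> class_Kinfty alpha ->
  (forall s, 0 <= s -> c <= g s) ->
  (forall u v, 0 <= u -> 0 <= v -> alpha (Rabs (v - u)) <= Rabs (g v - g u)) ->
  forall u v, 0 <= u -> u <= v -> alpha (v - u) <= g v - g u.
Proof.
intros Cg Ka Hc Hg u v Hu Huv.
assert (Hpos : forall s, 0 < s -> 0 < alpha s).
{ destruct Ka as ((H0 & H1 & _) & _); intros s Hs; rewrite <- H0; apply H1; lra. }
destruct Huv as [Huv| <-].
2:{ rewrite !Rminus_eq_0; destruct Ka as ((-> & _) & _); lra. }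
assert (H := Hg u v Hu ltac:(lra)).
rewrite Rabs_pos_eq in H by lra.
destruct (Rle_lt_dec (g u) (g v)) as [Hle|Hlt].
{ rewrite Rabs_pos_eq in H by lra; exact H. }
exfalso.
destruct (class_Kinfty_unbounded alpha (g u - c) Ka) as (s0 & Hs0 & Hbig).
(* [w] is so far out that [g w < g u] would force [g w < c]. Hence [g] comes back to the value [g u]
   between [v] and [w], against the growth bound. *)
pose (w := v + s0 + 1).
assert (Hw : g u <= g w).
{ apply Rnot_lt_le; intros Hwu.
  assert (B := Hbig (w - u) ltac:(unfold w; lra)).
  assert (G := Hg u w Hu ltac:(unfold w; lra)).
  rewrite Rabs_pos_eq in G by (unfold w; lra).
  rewrite Rabs_left in G by lra.
  assert (Q := Hc w ltac:(unfold w; lra)); lra. }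
destruct (continuous_IVT g v w (g u) Cg ltac:(unfold w; lra) Hlt Hw) as (t & Ht & E).
assert (G := Hg u t Hu ltac:(lra)).
rewrite E, Rminus_eq_0, Rabs_R0, Rabs_pos_eq in G by lra.
assert (Q := Hpos (t - u) ltac:(lra)); lra.
Qed.

(** * Symmetries of the dither and of the averaged drift *)

Lemma dither_continuous t : continuous dither t.
Proof. apply (ex_derive_continuous dither); unfold dither; auto_derive; easy. Qed.

Lemma dither_bound t : Rabs (dither t) <= 1.
Proof. apply Rabs_le_between, SIN_bound. Qed.

Lemma dither_half t : 0 <= t <= 1 / 2 -> 0 <= dither t.
Proof. intros Ht; assert (P := PI_RGT_0); apply sin_ge_0; nra. Qed.

Lemma dither_shift_half t : dither (t + 1 / 2) = - dither t.
Proof.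
unfold dither; replace (2 * PI * (t + 1 / 2)) with (2 * PI * t + PI) by field.
apply neg_sin.
Qed.

Lemma dither_shift_int n t : dither (t + INR n) = dither t.
Proof.
unfold dither; replace (2 * PI * (t + INR n)) with (2 * PI * t + 2 * INR n * PI) by ring.
apply sin_period.
Qed.

Lemma dithered_continuous (h : R -> R) (x delta : R) t :
  (forall x, continuous h x) -> continuous (fun t => h (x + delta * dither t)) t.
Proof.
intros Ch; apply (continuous_comp (fun t => x + delta * dither t) h); [|apply Ch].
apply (continuous_plus (fun _ => x) (fun t => delta * dither t)).
- apply continuous_const.
- apply (continuous_scal_r delta dither), dither_continuous.
Qed.

Lemma continuous_mult_dither (f : R -> R) t :
  continuous f t -> continuous (fun t => f t * dither t) t.
Proof. intros Cf; apply (continuous_mult f dither); [exact Cf|apply dither_continuous]. Qed.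

Lemma dithered_product_continuous (h : R -> R) (x delta : R) t :
  (forall x, continuous h x) ->
  continuous (fun t => h (x + delta * dither t) * dither t) t.
Proof. intros Ch; apply continuous_mult_dither, dithered_continuous, Ch. Qed.

(** The dither changes sign under a shift by 1/2, so the second half of the period folds onto the
    first. There the weight is nonnegative and [h] enters through a symmetric difference. *)
Lemma b1_half_period (h : R -> R) (delta x : R) :
  (forall x, continuous h x) ->
  b1 h delta x =
  2 * RInt (fun t => (h (x + delta * dither t) - h (x - delta * dither t)) * dither t)
        0 (1 / 2).
Proof.
intros Ch; unfold b1; f_equal.
set (f := fun t => h (x + delta * dither t) * dither t).
change (RInt f 0 1 = RInt (fun t => (h (x + delta * dither t) - h (x - delta * dither t)) * dither t) 0 (1 / 2)).
assert (Cf : forall t, continuous f t)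
  by (intros; apply dithered_product_continuous, Ch).
assert (Hf : forall a b, ex_RInt f a b) by (intros; apply continuous_ex_RInt, Cf).
rewrite <- (RInt_Chasles f 0 (1 / 2) 1) by apply Hf.
assert (E : RInt f (1 / 2) 1 = RInt (fun t => f (t + 1 / 2)) 0 (1 / 2)).
{ assert (C := RInt_comp_lin f 1 (1 / 2) 0 (1 / 2) (Hf _ _)).
  replace (1 * 0 + 1 / 2) with (1 / 2) in C by field.
  replace (1 * (1 / 2) + 1 / 2) with 1 in C by field.
  rewrite <- C.
  apply RInt_ext; intros t _; unfold scal; simpl; unfold mult; simpl.
  rewrite !Rmult_1_l; reflexivity. }
rewrite E, <- (RInt_plus f (fun t => f (t + 1 / 2))).
- apply RInt_ext; intros t _; unfold f, plus; simpl; rewrite dither_shift_half.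
  replace (x + delta * - dither t) with (x - delta * dither t) by ring; ring.
- apply Hf.
- apply continuous_ex_RInt; intros t.
  apply (continuous_comp (fun t => t + 1 / 2) f); [|apply Cf].
  apply (continuous_plus (fun t => t) (fun _ => 1 / 2));
    [apply continuous_id|apply continuous_const].
Qed.

Section Separation.

Variables (h m alpha : R -> R) (xstar A delta bbar : R).
Hypothesis h_minimum : assumption1 h xstar.
Hypothesis h_sandwich : assumption2 h xstar m alpha A.
Hypothesis delta_pos : 0 < delta.
Hypothesis delta_large : delta_lower alpha delta >= A + bbar.

Let h_continuous x : continuous h x.
Proof. apply smooth_continuous, h_minimum. Qed.

(** The lower bound demanded by [increase_of_growth] is [h xstar - A], from the minimality of
    [xstar] and the sandwich between [h] and [m]. *)
Lemma m_increasing u v : xstar <= u -> u <= v -> alpha (v - u) <= m v - m u.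
Proof.
destruct h_minimum as (_ & Hmin).
destruct h_sandwich as (Lm & _ & Ka & _ & Hhm & Hm).
intros Hu Hv.
replace (v - u) with ((v - xstar) - (u - xstar)) by ring.
replace (m v) with (m (xstar + (v - xstar))) by (f_equal; ring).
replace (m u) with (m (xstar + (u - xstar))) by (f_equal; ring).
apply (increase_of_growth (fun s => m (xstar + s)) alpha (h xstar - A)); try lra.
- intros t; apply (continuous_comp (fun t => xstar + t) m).
  + apply (continuous_plus (fun _ => xstar) (fun t => t));
      [apply continuous_const|apply continuous_id].
  + apply locally_Lipschitz_continuous, Lm.
- exact Ka.
- intros s Hs; specialize (Hhm (xstar + s)).
  destruct (Req_dec (xstar + s) xstar) as [E|E]; [rewrite E in *; lra|].
  specialize (Hmin _ E); lra.
- intros a b Ha Hb; specialize (Hm (xstar + a) (xstar + b)).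
  replace (xstar + b - (xstar + a)) with (b - a) in Hm by ring.
  apply Rge_le, Hm; nra.
Qed.

Lemma m_decreasing u v : u <= v -> v <= xstar -> alpha (v - u) <= m u - m v.
Proof.
destruct h_minimum as (_ & Hmin).
destruct h_sandwich as (Lm & _ & Ka & _ & Hhm & Hm).
intros Hu Hv.
replace (v - u) with ((xstar - u) - (xstar - v)) by ring.
replace (m v) with (m (xstar - (xstar - v))) by (f_equal; ring).
replace (m u) with (m (xstar - (xstar - u))) by (f_equal; ring).
apply (increase_of_growth (fun s => m (xstar - s)) alpha (h xstar - A)); try lra.
- intros t; apply (continuous_comp (fun t => xstar - t) m).
  + apply (continuous_minus (fun _ => xstar) (fun t => t));
      [apply continuous_const|apply continuous_id].
  + apply locally_Lipschitz_continuous, Lm.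
- exact Ka.
- intros s Hs; specialize (Hhm (xstar - s)).
  destruct (Req_dec (xstar - s) xstar) as [E|E]; [rewrite E in *; lra|].
  specialize (Hmin _ E); lra.
- intros a b Ha Hb; specialize (Hm (xstar - a) (xstar - b)).
  replace (xstar - b - (xstar - a)) with (- (b - a)) in Hm by ring.
  rewrite Rabs_Ropp in Hm.
  apply Rge_le, Hm; nra.
Qed.

Let alpha_plus t := alpha (Rmax 0 (delta * dither t)).

Let alpha_plus_eq t : 0 <= t <= 1 / 2 -> alpha_plus t = alpha (delta * dither t).
Proof.
intros Ht; unfold alpha_plus; rewrite Rmax_right; [easy|].
apply Rmult_le_pos; [lra|apply dither_half, Ht].
Qed.

Let alpha_plus_continuous t : continuous alpha_plus t.
Proof.
apply (continuous_comp (fun t => delta * dither t) (fun y => alpha (Rmax 0 y))).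
- apply (continuous_scal_r delta dither), dither_continuous.
- apply class_K_continuous; destruct h_sandwich as (_ & _ & [Ka _] & _); exact Ka.
Qed.

(* Chebyshev's association inequality: [s] and [alpha (delta s)] increase together, so the
   threshold [sigma] where [alpha (delta s)] passes its mean lower bound [A + bbar] makes
   [(alpha (delta s) - A - bbar) * (s - sigma)] nonnegative. *)
Lemma weighted_growth :
  bbar * RInt dither 0 (1 / 2)
    <= RInt (fun t => (alpha_plus t - A) * dither t) 0 (1 / 2).
Proof.
destruct h_sandwich as (_ & _ & [[_ [Hinc _]] _] & HA & _).
assert (Halpha : forall s t, 0 <= s -> s <= t -> alpha (delta * s) <= alpha (delta * t)).
{ intros s t Hs [Hst| ->]; [|lra]; left; apply Hinc; nra. }
(* 0 belongs to [E] by decree, whatever the sign of [A + bbar], so the supremum exists and is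
   nonnegative. *)
pose (E := fun s => s <= 1 /\ (s = 0 \/ 0 <= s /\ alpha (delta * s) <= A + bbar)).
destruct (completeness E) as [sigma [ub lub]].
{ exists 1; intros s [Hs _]; exact Hs. }
{ exists 0; split; [lra|now left]. }
assert (Hsigma : 0 <= sigma) by (apply ub; split; [lra|now left]).
assert (Hprod : forall t, 0 <= t <= 1 / 2 ->
  0 <= (alpha_plus t - A - bbar) * (dither t - sigma)).
{ intros t Ht; rewrite (alpha_plus_eq t Ht).
  assert (H0 := dither_half t Ht).
  assert (H1 : dither t <= 1) by (eapply Rle_trans; [apply RRle_abs|apply dither_bound]).
  destruct (Rtotal_order (dither t) sigma) as [Hlt|[->|Hgt]].
  - assert (alpha (delta * dither t) <= A + bbar); [|nra].
    apply Rnot_lt_le; intros Habove.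
    enough (sigma <= dither t) by lra.
    apply lub; intros s [_ [->|[Hs1 Hs2]]]; [exact H0|].
    apply Rnot_lt_le; intros Hs.
    assert (Q := Halpha (dither t) s H0 (Rlt_le _ _ Hs)); lra.
  - rewrite Rminus_eq_0; lra.
  - assert (A + bbar <= alpha (delta * dither t)); [|nra].
    apply Rnot_lt_le; intros Hbelow.
    enough (dither t <= sigma) by lra.
    apply ub; split; [exact H1|right; lra]. }
assert (C1 : forall t, continuous (fun t => (alpha_plus t - A) * dither t) t).
{ intros t; apply continuous_mult_dither.
  apply (continuous_minus alpha_plus (fun _ => A)); [|apply continuous_const].
  apply alpha_plus_continuous. }
assert (I1 := RInt_correct _ _ _ (continuous_ex_RInt _ 0 (1 / 2) C1)).
assert (I2 := RInt_correct _ _ _ (continuous_ex_RInt _ 0 (1 / 2) dither_continuous)).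
assert (I3 := RInt_correct _ _ _ (continuous_ex_RInt _ 0 (1 / 2) alpha_plus_continuous)).
assert (Emean : RInt alpha_plus 0 (1 / 2) = delta_lower alpha delta / 2).
{ unfold delta_lower.
  replace (RInt (fun t => alpha (delta * sin (2 * PI * t))) 0 (1 / 2))
    with (RInt alpha_plus 0 (1 / 2)); 
    [assert (Hhalf : forall I, I = 2 * I / 2) by (intros; field); apply Hhalf|].
  apply RInt_ext; rewrite Rmin_left, Rmax_right by lra; intros t Ht.
  apply alpha_plus_eq; lra. }
assert (I4 := is_RInt_const (V := R_NormedModule) 0 (1 / 2) (sigma * (A + bbar))).
(* The integrand is the expanded product of [Hprod]. Apart from the two integrals of the claim, it
   leaves [sigma * (delta_lower alpha delta - (A + bbar)) / 2], which is nonnegative. *)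
assert (I5 := is_RInt_minus _ _ _ _ _ _ I1
  (is_RInt_plus _ _ _ _ _ _ (is_RInt_scal _ _ _ bbar _ I2)
     (is_RInt_minus _ _ _ _ _ _ (is_RInt_scal _ _ _ sigma _ I3) I4))).
rewrite Emean in I5.
assert (P : (1 / 2 - 0) * 0 <= RInt (fun t => (alpha_plus t - A) * dither t) 0 (1 / 2)
  - (bbar * RInt dither 0 (1 / 2)
     + (sigma * (delta_lower alpha delta / 2) - (1 / 2 - 0) * (sigma * (A + bbar))))).
{ apply (is_RInt_le _ _ 0 (1 / 2) _ _ ltac:(lra)
    (is_RInt_const (V := R_NormedModule) 0 (1 / 2) 0) I5).
  intros t Ht; specialize (Hprod t ltac:(lra)).
  unfold minus, plus, opp, scal; simpl; unfold mult; simpl; lra. }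
assert (Q := Rmult_le_compat_l sigma _ _ Hsigma (Rge_le _ _ delta_large)); lra.
Qed.

Lemma dither_half_integral_pos : 0 < RInt dither 0 (1 / 2).
Proof.
apply RInt_gt_0; [lra| |intros; apply dither_continuous].
intros t Ht; assert (P := PI_RGT_0); apply sin_gt_0; nra.
Qed.

Let h_diff_continuous x t :
  continuous (fun t => (h (x + delta * dither t) - h (x - delta * dither t)) * dither t) t.
Proof.
apply continuous_mult_dither.
apply (continuous_minus (fun t => h (x + delta * dither t))).
- apply dithered_continuous, h_continuous.
- apply continuous_ext with (fun t => h (x + (- delta) * dither t)).
  + intros; f_equal; ring.
  + apply dithered_continuous, h_continuous.
Qed.

Let alpha_plus_ex_RInt c : ex_RInt (fun t => c * ((alpha_plus t - A) * dither t)) 0 (1 / 2).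
Proof.
apply continuous_ex_RInt; intros t.
apply (continuous_scal_r c (fun t => (alpha_plus t - A) * dither t)), continuous_mult_dither.
apply (continuous_minus alpha_plus (fun _ => A)); [|apply continuous_const].
apply alpha_plus_continuous.
Qed.

Let RInt_alpha_plus c : RInt (fun t => c * ((alpha_plus t - A) * dither t)) 0 (1 / 2)
  = c * RInt (fun t => (alpha_plus t - A) * dither t) 0 (1 / 2).
Proof.
apply (RInt_scal (fun t => (alpha_plus t - A) * dither t) 0 (1 / 2) c).
apply ex_RInt_ext with (2 := alpha_plus_ex_RInt 1); intros; apply Rmult_1_l.
Qed.

(** All points [x - delta * dither t] with [t] in the half period lie right of [xstar]. Growth of
    [m] applied on both sides of [x] gives [2 * alpha], the sandwich costs [2 * A], and the factor 2
    in [b1] makes the constant 4. *)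
Lemma b1_right x : xstar + delta <= x ->
  4 * bbar * RInt dither 0 (1 / 2) <= b1 h delta x.
Proof.
intros Hx; rewrite b1_half_period by exact h_continuous.
assert (W := weighted_growth).
enough (RInt (fun t => 2 * ((alpha_plus t - A) * dither t)) 0 (1 / 2) <=
        RInt (fun t => (h (x + delta * dither t) - h (x - delta * dither t)) * dither t) 0 (1 / 2))
  by (rewrite RInt_alpha_plus in H; lra).
apply RInt_le; [lra|apply alpha_plus_ex_RInt| |].
- apply continuous_ex_RInt, h_diff_continuous.
- intros t Ht; rewrite alpha_plus_eq by lra.
  assert (Hd := dither_half t ltac:(lra)).
  assert (Hd1 : dither t <= 1) by (eapply Rle_trans; [apply RRle_abs|apply dither_bound]).
  rewrite <- Rmult_assoc; apply Rmult_le_compat_r; [exact Hd|].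
  assert (U := m_increasing (x - delta * dither t) x ltac:(nra) ltac:(nra)).
  assert (V := m_increasing x (x + delta * dither t) ltac:(nra) ltac:(nra)).
  replace (x - (x - delta * dither t)) with (delta * dither t) in U by ring.
  replace (x + delta * dither t - x) with (delta * dither t) in V by ring.
  destruct h_sandwich as (_ & _ & _ & _ & Hs & _).
  assert (B := Hs (x + delta * dither t)); assert (C := Hs (x - delta * dither t)); lra.
Qed.

Lemma b1_left x : x <= xstar - delta ->
  b1 h delta x <= - (4 * bbar * RInt dither 0 (1 / 2)).
Proof.
intros Hx; rewrite b1_half_period by exact h_continuous.
assert (W := weighted_growth).
enough (RInt (fun t => (h (x + delta * dither t) - h (x - delta * dither t)) * dither t) 0 (1 / 2)
        <= RInt (fun t => -2 * ((alpha_plus t - A) * dither t)) 0 (1 / 2))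
  by (rewrite RInt_alpha_plus in H; lra).
apply RInt_le; [lra| |apply alpha_plus_ex_RInt|].
- apply continuous_ex_RInt, h_diff_continuous.
- intros t Ht; rewrite alpha_plus_eq by lra.
  assert (Hd := dither_half t ltac:(lra)).
  assert (Hd1 : dither t <= 1) by (eapply Rle_trans; [apply RRle_abs|apply dither_bound]).
  rewrite <- Rmult_assoc; apply Rmult_le_compat_r; [exact Hd|].
  assert (U := m_decreasing (x - delta * dither t) x ltac:(nra) ltac:(nra)).
  assert (V := m_decreasing x (x + delta * dither t) ltac:(nra) ltac:(nra)).
  replace (x - (x - delta * dither t)) with (delta * dither t) in U by ring.
  replace (x + delta * dither t - x) with (delta * dither t) in V by ring.
  destruct h_sandwich as (_ & _ & _ & _ & Hs & _).
  assert (B := Hs (x + delta * dither t)); assert (C := Hs (x - delta * dither t)); lra.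
Qed.

End Separation.

Lemma b1_Lipschitz (h : R -> R) (delta x y K : R) :
  0 < delta -> (forall x, continuous h x) ->
  (forall t, Rabs (h (x + delta * dither t) - h (y + delta * dither t)) <= K) ->
  Rabs (b1 h delta x - b1 h delta y) <= 2 * K.
Proof.
intros Hdelta Ch HK; unfold b1.
change (Rabs (2 * RInt (fun t => h (x + delta * dither t) * dither t) 0 1
  - 2 * RInt (fun t => h (y + delta * dither t) * dither t) 0 1) <= 2 * K).
rewrite <- Rmult_minus_distr_l, Rabs_mult, (Rabs_pos_eq 2) by lra.
apply Rmult_le_compat_l; [lra|].
assert (C : forall z t, continuous (fun t => h (z + delta * dither t) * dither t) t)
  by (intros; apply dithered_product_continuous, Ch).
assert (E := RInt_minus _ _ _ _ (continuous_ex_RInt _ 0 1 (C x))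
                                (continuous_ex_RInt _ 0 1 (C y))).
unfold minus at 2, plus, opp in E; simpl in E; unfold Rminus; rewrite <- E.
replace K with ((1 - 0) * K) by ring.
apply abs_RInt_le_const; [lra| |].
- apply continuous_ex_RInt; intros t.
  apply (continuous_minus (fun t => h (x + delta * dither t) * dither t)); apply C.
- intros t _; unfold minus, plus, opp; simpl.
  replace (h (x + delta * dither t) * dither t + - (h (y + delta * dither t) * dither t))
    with ((h (x + delta * dither t) - h (y + delta * dither t)) * dither t) by ring.
  rewrite Rabs_mult.
  assert (P := dither_bound t); assert (Q := Rabs_pos (dither t)).
  assert (S := Rabs_pos (h (x + delta * dither t) - h (y + delta * dither t))).
  specialize (HK t); nra.
Qed.

(** * The attractor is an interval *)

Lemma nonzero_keeps_sign (f : R -> R) a b :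
  a <= b -> (forall t, a <= t <= b -> continuity_pt f t) ->
  (forall t, a <= t <= b -> f t <> 0) -> 0 < f b -> 0 < f a.
Proof.
intros [Hab| ->] Cf Hf Hb; [|exact Hb].
apply Rnot_le_lt; intros [Ha|Ha].
- destruct (IVT_interv f a b Cf Hab Ha Hb) as (z & Hz & E); exact (Hf z Hz E).
- apply (Hf a); [lra|exact Ha].
Qed.

Section Attractor.

Variables (b : R -> R) (S : R -> Prop).
Hypothesis S_nonempty : exists a, S a.
Hypothesis S_stable : globally_asymptotically_stable (average_field b 1) S.

Let D := dist_set S.

Let D_continuous x : continuous D x.
Proof.
apply Lipschitz_continuous with 1; [lra|]; intros u v; unfold D.
assert (A := dist_set_triangle S S_nonempty u v).
assert (B := dist_set_triangle S S_nonempty v u).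
rewrite (Rabs_minus_sym v u) in B; apply Rabs_le_between; lra.
Qed.

(** The constant solution at [x] has a constant distance to [S], which attractivity sends to 0. *)
Lemma equilibrium_in_attractor x : b x = 0 -> dist_set S x = 0.
Proof.
intros Hx; destruct S_stable as (_ & _ & Hattr).
assert (Hsol : solution (average_field b 1) (fun _ => x)).
{ apply solution_of_derive; intros t _; unfold average_field; rewrite Hx, Rmult_0_r.
  apply (is_derive_const (V := R_NormedModule) x t). }
assert (H := is_lim_unique _ _ _ (Hattr _ Hsol)).
cbv beta in H; rewrite Lim_const in H; injection H; easy.
Qed.

(* A solution started in [S] next to [p] cannot leave, by stability, and cannot come back,
   by the sign of [b]; so it does not tend to [S]. *)
Lemma no_repelling_side sigma p l :
  sigma = 1 \/ sigma = -1 -> 0 < l -> dist_set S p = 0 ->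
  (forall s, 0 < s <= l -> 0 < dist_set S (p + sigma * s) /\ sigma * b (p + sigma * s) < 0) ->
  False.
Proof.
intros Hsigma Hl Hp Hside; destruct S_stable as (Hex & Hstab & Hattr).
assert (Hs2 : sigma * sigma = 1) by (destruct Hsigma as [-> | ->]; ring).
assert (Habs : forall s, 0 <= s -> Rabs (sigma * s) = s).
{ intros s Hs; rewrite Rabs_mult, (Rabs_pos_eq s) by assumption.
  destruct Hsigma as [-> | ->]; unfold Rabs; destruct Rcase_abs; lra. }
destruct (Hside l ltac:(lra)) as [Hfar _].
(* With half the distance at the far end as tolerance, the solution can never reach
   [p + sigma * l]. *)
destruct (Hstab (dist_set S (p + sigma * l) / 2)) as (eta & Heta & Hnear); [lra|].
pose (s0 := Rmin eta (l / 2)).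
assert (Hs0 : 0 < s0 <= eta /\ s0 < l).
{ unfold s0, Rmin; destruct (Rle_dec _ _); lra. }
destruct (Hex (p + sigma * s0)) as (x & Hx0 & Hsol).
specialize (Hnear x Hsol).
assert (Hclose : dist_set S (x 0) <= eta).
{ assert (T := dist_set_triangle S S_nonempty (x 0) p).
  rewrite Hx0, Rplus_minus_l, Habs in T by lra; rewrite Hx0; lra. }
specialize (Hnear Hclose).
pose (g := fun t => sigma * (x (Rmax 0 t) - p)).
assert (Hxg : forall t, 0 <= t -> x t = p + sigma * g t).
{ intros t Ht; unfold g; rewrite Rmax_right by assumption.
  rewrite <- Rmult_assoc, Hs2; ring. }
assert (Cg : forall t, continuous g t).
{ intros t; apply (continuous_scal_r sigma (fun t => x (Rmax 0 t) - p)).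
  apply (continuous_minus (fun t => x (Rmax 0 t)) (fun _ => p));
    [exact (solution_continuous _ x Hsol t)|apply continuous_const]. }
assert (Dg : forall t, 0 < t -> is_derive g t (sigma * (- (1 / 2) * b (x t)))).
{ intros t Ht; apply is_derive_scal.
  replace (- (1 / 2) * b (x t)) with (minus (average_field b 1 t (x t)) 0).
  - apply (is_derive_minus (fun t => x (Rmax 0 t)) (fun _ => p)).
    + exact (solution_derive _ x Hsol t Ht).
    + apply (is_derive_const (V := R_NormedModule) p t).
  - unfold average_field, minus, plus, opp; simpl; ring. }
assert (g0 : g 0 = s0).
{ unfold g; rewrite Rmax_left, Hx0, Rplus_minus_l, <- Rmult_assoc, Hs2; lra. }
assert (Hlow : forall t, 0 <= t -> s0 / 2 <= g t).
{ apply (barrier g (fun t => sigma * (- (1 / 2) * b (x t)))); [exact Cg|exact Dg|lra|].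
  intros t Ht E; rewrite (Hxg t), E by lra.
  destruct (Hside (s0 / 2) ltac:(lra)); lra. }
assert (Hup : forall t, 0 <= t -> g t <= l).
{ intros t Ht; apply Rnot_lt_le; intros Hlt.
  destruct (continuous_IVT g 0 t l Cg Ht ltac:(lra) ltac:(lra)) as (w & Hw & E).
  specialize (Hnear w ltac:(lra)); rewrite Hxg, E in Hnear by lra; lra. }
(* The solution stays in a compact segment on which the distance to [S] has a positive minimum,
   against attractivity. *)
destruct (continuity_ab_min (fun s => D (p + sigma * s)) (s0 / 2) l) as (u & Hu & Hu').
{ lra. }
{ intros c _; apply continuity_pt_filterlim.
  apply (continuous_comp (fun s => p + sigma * s) D); [|apply D_continuous].
  apply (ex_derive_continuous (fun s => p + sigma * s)); auto_derive; easy. }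
destruct (Hside u ltac:(lra)) as [Hpos _].
assert (Hlim : Rbar_le (D (p + sigma * u)) 0).
{ refine (is_lim_le_loc _ _ p_infty _ _ _ (is_lim_const _ _) (Hattr x Hsol)).
  exists 0; intros t Ht; rewrite Hxg by lra.
  apply (Hu (g t)); split; [apply Hlow|apply Hup]; lra. }
change (D (p + sigma * u) <= 0) in Hlim; unfold D in Hlim; lra.
Qed.

(** Otherwise walk from [z] towards the point of [S] up to the first point at distance 0. On the way
    there is no equilibrium, so [b] keeps its outward sign, and the end point has a repelling
    side. *)
Lemma pointing_to_attractor sigma z k :
  sigma = 1 \/ sigma = -1 -> 0 <= k -> S (z - sigma * k) ->
  (forall s, 0 <= s <= k -> continuity_pt b (z - sigma * s)) ->
  0 < dist_set S z -> 0 <= sigma * b z.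
Proof.
intros Hsigma Hk Sk Cb Hz; apply Rnot_lt_le; intros Hneg.
destruct (first_hit (fun s => - D (z - sigma * s)) 0 k 0) as (l & Hl & E & Hbelow).
{ intros s; apply (continuous_opp (fun s => D (z - sigma * s))).
  apply (continuous_comp (fun s => z - sigma * s) D); [|apply D_continuous].
  apply (ex_derive_continuous (fun s => z - sigma * s)); auto_derive; easy. }
{ exact Hk. }
{ rewrite Rmult_0_r, Rminus_0_r; unfold D; lra. }
{ assert (B := dist_set_le S S_nonempty (z - sigma * k) _ Sk).
  rewrite Rminus_eq_0, Rabs_R0 in B; unfold D; lra. }
assert (Hb : forall s, 0 <= s < l -> sigma * b (z - sigma * s) < 0).
{ intros s Hs.
  enough (0 < - (sigma * b (z - sigma * (s - 0)))) by (rewrite Rminus_0_r in *; lra).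
  apply (nonzero_keeps_sign (fun w => - (sigma * b (z - sigma * (s - w)))) 0 s); [lra| | |].
  - intros w Hw; apply continuity_pt_filterlim.
    apply (continuous_opp (fun w => sigma * b (z - sigma * (s - w)))).
    apply (continuous_scal_r sigma (fun w => b (z - sigma * (s - w)))).
    apply (continuous_comp (fun w => z - sigma * (s - w)) b).
    + apply (ex_derive_continuous (fun w => z - sigma * (s - w))); auto_derive; easy.
    + apply continuity_pt_filterlim, Cb; lra.
  - intros w Hw Hzero.
    assert (Hb0 : b (z - sigma * (s - w)) = 0) by (destruct Hsigma as [-> | ->]; lra).
    apply equilibrium_in_attractor in Hb0.
    specialize (Hbelow (s - w) ltac:(lra)); cbv beta in Hbelow; unfold D in Hbelow; lra.
  - rewrite Rminus_eq_0, Rmult_0_r, Rminus_0_r; lra. }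
apply (no_repelling_side sigma (z - sigma * l) l Hsigma); [lra| |].
- unfold D in E; lra.
- intros s Hs; replace (z - sigma * l + sigma * s) with (z - sigma * (l - s)) by ring.
  split; [|apply Hb; lra].
  specialize (Hbelow (l - s) ltac:(lra)); cbv beta in Hbelow; unfold D in Hbelow; lra.
Qed.

(** In a gap the drift would have to point to [S] on both sides at once; then [b z = 0], and an
    equilibrium is at distance 0. *)
Lemma attractor_convex z a a' :
  S a -> S a' -> a <= z <= a' ->
  (forall x, a <= x <= a' -> continuity_pt b x) -> dist_set S z = 0.
Proof.
intros Sa Sa' Hz Cb.
destruct (dist_set_pos S S_nonempty z) as [Hpos|]; [exfalso|easy].
assert (A : 0 <= 1 * b z).
{ apply (pointing_to_attractor 1 z (z - a)); [now left|lra| | |exact Hpos].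
  - now replace (z - 1 * (z - a)) with a by ring.
  - intros s Hs; apply Cb; lra. }
assert (B : 0 <= -1 * b z).
{ apply (pointing_to_attractor (-1) z (a' - z)); [now right|lra| | |exact Hpos].
  - now replace (z - -1 * (a' - z)) with a' by ring.
  - intros s Hs; apply Cb; lra. }
assert (E := equilibrium_in_attractor z ltac:(lra)); lra.
Qed.

(** Beyond [e] there is no equilibrium, so [b] keeps the sign it has at [B]; compactness of the
    segment from [e + d] to [B] yields a positive minimum. The sign [sigma] treats both ends of [S]
    at once. *)
Lemma push_towards_attractor sigma e B c0 d :
  sigma = 1 \/ sigma = -1 -> (forall a, S a -> sigma * a <= e) ->
  0 < c0 -> (forall s, B <= s -> c0 <= sigma * b (sigma * s)) ->
  (forall s, e <= s <= B -> continuity_pt b (sigma * s)) ->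
  0 < d -> exists c, 0 < c /\ forall s, e + d <= s -> c <= sigma * b (sigma * s).
Proof.
intros Hsigma He Hc0 HB Cb Hd.
destruct (Rle_lt_dec B (e + d)) as [Hle|Hlt].
{ exists c0; split; [exact Hc0|]; intros s Hs; apply HB; lra. }
pose (f := fun s => sigma * b (sigma * s)).
assert (Cf : forall s, e <= s <= B -> continuity_pt f s).
{ intros s Hs; apply continuity_pt_filterlim.
  apply (continuous_scal_r sigma (fun s => b (sigma * s))).
  apply (continuous_comp (fun s => sigma * s) b).
  - apply (ex_derive_continuous (fun s => sigma * s)); auto_derive; easy.
  - apply continuity_pt_filterlim, Cb, Hs. }
assert (Hf : forall s, e < s -> f s <> 0).
{ intros s Hs Hzero.
  assert (Hb0 : b (sigma * s) = 0) by (unfold f in Hzero; destruct Hsigma as [-> | ->]; lra).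
  apply equilibrium_in_attractor in Hb0.
  assert (Hlow : s - e <= dist_set S (sigma * s)); [|lra].
  apply dist_set_lower_bound; [exact S_nonempty|]; intros a Sa; specialize (He a Sa).
  destruct Hsigma as [-> | ->]; unfold Rabs; destruct Rcase_abs; lra. }
destruct (continuity_ab_min f (e + d) B) as (u & Hu & Hu').
{ lra. }
{ intros s Hs; apply Cf; lra. }
assert (Hpos : 0 < f u).
{ apply (nonzero_keeps_sign f u B); [lra| | |].
  - intros s Hs; apply Cf; lra.
  - intros s Hs; apply Hf; lra.
  - assert (Q := HB B (Rle_refl B)); unfold f; lra. }
exists (Rmin c0 (f u)); split; [now apply Rmin_pos|].
intros s Hs; destruct (Rle_lt_dec B s).
- eapply Rle_trans; [apply Rmin_l|]; now apply HB.
- eapply Rle_trans; [apply Rmin_r|]; apply Hu; lra.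
Qed.

(* [a1] and [a2] are the endpoints of the closure of [S]. *)
Lemma attractor_interval lo hi c0 :
  (forall a, S a -> lo <= a <= hi) -> 0 < c0 ->
  (forall x, hi <= x -> c0 <= b x) -> (forall x, x <= lo -> b x <= - c0) ->
  (forall x, lo <= x <= hi -> continuity_pt b x) ->
  exists a1 a2, is_lub S a2 /\ is_lub (fun y => S (- y)) (- a1) /\
    (forall x, a1 <= x <= a2 -> dist_set S x = 0) /\
    forall d, 0 < d -> exists c, 0 < c /\
      forall x, (a2 + d <= x -> c <= b x) /\ (x <= a1 - d -> b x <= - c).
Proof.
intros HS Hc0 Hhi Hlo Cb; destruct S_nonempty as [a0 Sa0].
destruct (completeness S) as [a2 lub2].
{ exists hi; intros a Sa; apply HS, Sa. }
{ now exists a0. }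
destruct (completeness (fun y => S (- y))) as [e lub1].
{ exists (- lo); intros y Sy; apply HS in Sy; lra. }
{ exists (- a0); now rewrite Ropp_involutive. }
exists (- e), a2; rewrite Ropp_involutive.
assert (up2 : forall a, S a -> a <= a2) by (apply lub2).
assert (up1 : forall a, S a -> - e <= a).
{ intros a Sa; assert (- a <= e); [|lra].
  apply lub1; now rewrite Ropp_involutive. }
assert (Ha2 : a2 <= hi) by (apply lub2; intros a Sa; apply HS, Sa).
assert (He : e <= - lo) by (apply lub1; intros y Sy; apply HS in Sy; lra).
split; [exact lub2|split; [exact lub1|split]].
- intros x Hx.
  destruct (dist_set_pos S S_nonempty x) as [Hpos|]; [exfalso|easy].
  assert (Hgap := dist_set_le S S_nonempty x).
  destruct (classic (exists a, S a /\ a <= x)) as [(a & Sa & Hax)|Hnone].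
  (* With all of [S] to the right of [x], the whole set is at least [dist_set S x] away, so its
     infimum [- e] would exceed [x]. *)
  2:{ enough (e <= - x - dist_set S x) by lra.
      apply lub1; intros y Sy; specialize (Hgap (- y) Sy).
      assert (x < - y) by (apply Rnot_le_lt; intros H; apply Hnone; eauto).
      rewrite Rabs_left in Hgap by lra; lra. }
  destruct (classic (exists a, S a /\ x <= a)) as [(a' & Sa' & Hax')|Hnone].
  2:{ enough (a2 <= x - dist_set S x) by lra.
      apply lub2; intros y Sy; specialize (Hgap y Sy).
      assert (y < x) by (apply Rnot_le_lt; intros H; apply Hnone; eauto).
      rewrite Rabs_pos_eq in Hgap by lra; lra. }
  assert (E : dist_set S x = 0); [|lra].
  apply (attractor_convex x a a'); [easy|easy|lra|].
  intros y Hy; apply Cb; apply HS in Sa, Sa'; lra.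
- intros d Hd.
  destruct (push_towards_attractor 1 a2 hi c0 d) as (c & Hc & Hpush);
    [now left|intros a Sa; rewrite Rmult_1_l; now apply up2|exact Hc0| | |exact Hd|].
  { intros s Hs; rewrite !Rmult_1_l; now apply Hhi. }
  { intros s Hs; rewrite Rmult_1_l; apply Cb.
    assert (Q := up2 a0 Sa0); assert (Q' := HS a0 Sa0); lra. }
  destruct (push_towards_attractor (-1) e (- lo) c0 d) as (c' & Hc' & Hpush');
    [now right|intros a Sa; specialize (up1 a Sa); lra|exact Hc0| | |exact Hd|].
  { intros s Hs; specialize (Hlo (-1 * s)); lra. }
  { intros s Hs; apply Cb.
    assert (Q := up1 a0 Sa0); assert (Q' := HS a0 Sa0); lra. }
  exists (Rmin c c'); split; [now apply Rmin_pos|]; intros x; split; intros Hx.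
  + specialize (Hpush x Hx); rewrite !Rmult_1_l in Hpush.
    assert (Q := Rmin_l c c'); lra.
  + specialize (Hpush' (- x) ltac:(lra)).
    replace (-1 * - x) with x in Hpush' by ring.
    assert (Q := Rmin_r c c'); lra.
Qed.

End Attractor.

(** * Sampling the dithered system once per period *)

Lemma RInt_dithered_shift (h : R -> R) (delta x : R) n :
  (forall x, continuous h x) ->
  RInt (fun t => h (x + delta * dither t) * dither t) (INR n) (INR n + 1) =
  b1 h delta x / 2.
Proof.
intros Ch; set (f := fun t => h (x + delta * dither t) * dither t).
assert (Cf : forall t, continuous f t)
  by (intros; apply dithered_product_continuous, Ch).
assert (C := RInt_comp_lin f 1 (INR n) 0 1 (continuous_ex_RInt f _ _ Cf)).
replace (1 * 0 + INR n) with (INR n) in C by ring.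
replace (1 * 1 + INR n) with (INR n + 1) in C by ring.
rewrite <- C.
assert (E : b1 h delta x = 2 * RInt f 0 1) by reflexivity.
rewrite E; replace (2 * RInt f 0 1 / 2) with (RInt f 0 1 : R)
  by (generalize (RInt f 0 1 : R); intros; field).
apply RInt_ext; intros t _; unfold scal, f; simpl; unfold mult; simpl.
rewrite !Rmult_1_l, dither_shift_int; reflexivity.
Qed.

Section Sampling.

Variables (h : R -> R) (delta gamma xstar r M L : R) (y : R -> R).
Hypothesis h_continuous : forall x, continuous h x.
Hypothesis delta_pos : 0 < delta.
Hypothesis gamma_pos : 0 < gamma.
Hypothesis M_nonneg : 0 <= M.
Hypothesis L_nonneg : 0 <= L.
Hypothesis h_bounded : forall x, xstar - r <= x <= xstar + r -> Rabs (h x) <= M.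
Hypothesis h_Lipschitz : forall x1 x2,
  xstar - r <= x1 <= xstar + r -> xstar - r <= x2 <= xstar + r ->
  Rabs (h x1 - h x2) <= L * Rabs (x1 - x2).
Hypothesis y_continuous : forall t, continuous y t.
(** Restricted to the tube so that [y] may come from the dithered equation or from its clipped
    version. *)
Hypothesis y_derive : forall t, 0 < t -> Rabs (y t - xstar) <= r - delta ->
  is_derive y t (dither_field h delta gamma t (y t)).

Lemma dithered_range x t : Rabs (x - xstar) <= r - delta ->
  xstar - r <= x + delta * dither t <= xstar + r.
Proof.
intros Hx; apply Rabs_le_between in Hx.
assert (B := dither_bound t); apply Rabs_le_between in B; nra.
Qed.

Lemma dither_field_bounded t x : Rabs (x - xstar) <= r - delta ->
  Rabs (dither_field h delta gamma t x) <= gamma * M.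
Proof.
intros Hx; unfold dither_field.
rewrite !Rabs_mult, Rabs_Ropp, (Rabs_pos_eq gamma) by lra.
assert (A := h_bounded _ (dithered_range x t Hx)); assert (B := dither_bound t).
assert (P := Rabs_pos (h (x + delta * dither t))); assert (Q := Rabs_pos (dither t)).
rewrite Rmult_assoc; apply Rmult_le_compat_l; nra.
Qed.

Section Period.

Variables (n : nat) (e : R).
Hypothesis start_in_tube : Rabs (y (INR n) - xstar) <= r - delta - e.
Hypothesis gamma_small : gamma * M < e.

Let in_tube x : Rabs (x - y (INR n)) <= e -> Rabs (x - xstar) <= r - delta.
Proof.
intros Hx; assert (T := Rabs_triang (x - y (INR n)) (y (INR n) - xstar)).
replace (x - y (INR n) + (y (INR n) - xstar)) with (x - xstar) in T by ring; lra.
Qed.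

Lemma period_excursion t : INR n <= t <= INR n + 1 ->
  Rabs (y t - y (INR n)) <= gamma * M.
Proof.
intros Ht; assert (Hn := pos_INR n).
assert (HgM : 0 <= gamma * M) by (apply Rmult_le_pos; lra).
apply Rle_trans with (gamma * M * (t - INR n)); [|nra].
apply (escape_bound y (INR n) (INR n + 1) (gamma * M) e); try easy; try lra.
intros s Hs Hsy; exists (dither_field h delta gamma s (y s)); split.
- apply y_derive; [lra|now apply in_tube].
- apply dither_field_bounded; now apply in_tube.
Qed.

(* Compare [y] with the motion obtained by freezing the state at the start of the period. *)
Lemma period_increment :
  Rabs (y (INR n + 1) - y (INR n) + gamma / 2 * b1 h delta (y (INR n)))
    <= gamma * (L * (gamma * M)).
Proof.
assert (Hn := pos_INR n); set (z := y (INR n)).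
pose (f := fun t => h (z + delta * dither t) * dither t).
assert (Cf : forall t, continuous f t)
  by (intros; apply dithered_product_continuous, h_continuous).
pose (g := fun t => y t + gamma * (0 + RInt f (INR n) t)).
assert (Df : forall t, is_derive (fun t => gamma * (0 + RInt f (INR n) t)) t (gamma * f t)).
{ intros t; apply (is_derive_scal (fun t => 0 + RInt f (INR n) t)).
  apply is_derive_primitive, Cf. }
assert (B : Rabs (g (INR n + 1) - g (INR n))
              <= gamma * (L * (gamma * M)) * (INR n + 1 - INR n)).
{ apply mean_value_bound; [|lra|].
  - intros t; apply (continuous_plus y (fun t => gamma * (0 + RInt f (INR n) t)));
      [apply y_continuous|eapply is_derive_continuous, Df].
  - intros t Ht.
    assert (Hex := period_excursion t ltac:(lra)); fold z in Hex.
    assert (Ht' : Rabs (y t - xstar) <= r - delta) by (apply in_tube; fold z; lra).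
    assert (Hz : Rabs (z - xstar) <= r - delta).
    { apply in_tube; fold z; rewrite Rminus_eq_0, Rabs_R0.
      assert (0 <= gamma * M) by (apply Rmult_le_pos; lra); lra. }
    exists (dither_field h delta gamma t (y t) + gamma * f t); split.
    + apply (is_derive_plus y (fun t => gamma * (0 + RInt f (INR n) t)));
        [apply y_derive; [lra|exact Ht']|apply Df].
    + unfold dither_field, f.
      replace (- gamma * h (y t + delta * dither t) * dither t
               + gamma * (h (z + delta * dither t) * dither t))
        with (gamma * ((h (z + delta * dither t) - h (y t + delta * dither t)) * dither t))
        by ring.
      rewrite !Rabs_mult, (Rabs_pos_eq gamma) by lra.
      apply Rmult_le_compat_l; [lra|].
      assert (A := h_Lipschitz _ _ (dithered_range z t Hz) (dithered_range (y t) t Ht')).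
      replace (z + delta * dither t - (y t + delta * dither t)) with (- (y t - z)) in A by ring.
      rewrite Rabs_Ropp in A.
      assert (U := dither_bound t); assert (V := Rabs_pos (dither t)).
      assert (W := Rabs_pos (h (z + delta * dither t) - h (y t + delta * dither t))).
      assert (L * Rabs (y t - z) <= L * (gamma * M)) by (apply Rmult_le_compat_l; lra).
      nra. }
unfold g in B; rewrite RInt_point in B.
change (zero : R) with 0 in B.
unfold f in B at 1; rewrite RInt_dithered_shift in B by exact h_continuous.
fold z in B |- *.
replace (y (INR n + 1) - z + gamma / 2 * b1 h delta z)
  with (y (INR n + 1) + gamma * (0 + b1 h delta z / 2) - (z + gamma * (0 + 0))) by field.
lra.
Qed.

End Period.

Section Convergence.

Variables (a1 a2 c d : R).
Hypothesis d_pos : 0 < d.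
Hypothesis c_pos : 0 < c.
Hypothesis a1_range : xstar - delta <= a1.
Hypothesis a1_le_a2 : a1 <= a2.
Hypothesis a2_range : a2 <= xstar + delta.
Hypothesis push_left : forall x, a2 + d / 2 <= x -> c <= b1 h delta x.
Hypothesis push_right : forall x, x <= a1 - d / 2 -> b1 h delta x <= - c.
Hypothesis r_large : d + 2 * delta < r.
Hypothesis start : Rabs (y 0 - xstar) <= r - d - 2 * delta.
Hypothesis gamma_small : gamma * M < d / 4.
Hypothesis gamma_small' : gamma * (L * M) <= c / 4.

(** The averaged drift gives [gamma * c / 2] per period, of which the averaging error may consume
    one half. *)
Let step := gamma * c / 4.

(** Either alternative leaves the margin [d / 4] needed for the next period: the band because
    [d + 2 * delta < r], the initial value by [start]. *)
Lemma samples_in_tube n :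
  Rmin (a1 - 3 * d / 4) (y 0 + INR n * step) <= y (INR n)
    <= Rmax (a2 + 3 * d / 4) (y 0 - INR n * step) ->
  Rabs (y (INR n) - xstar) <= r - delta - d / 4.
Proof.
intros Hn; apply Rabs_le_between in start.
assert (P : 0 <= INR n * step).
{ apply Rmult_le_pos; [apply pos_INR|]; unfold step; nra. }
apply Rabs_le_between; unfold Rmin, Rmax in Hn.
destruct (Rle_dec (a1 - 3 * d / 4) (y 0 + INR n * step)),
  (Rle_dec (a2 + 3 * d / 4) (y 0 - INR n * step)); lra.
Qed.

(** Beyond [d / 2] from the interval a sample moves inwards by at least [step]; otherwise the
    excursion, less than [d / 4], keeps the next one within [3 * d / 4]. The tube bound needed for
    each period comes from the induction hypothesis. *)
Lemma samples_bound n :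
  Rmin (a1 - 3 * d / 4) (y 0 + INR n * step) <= y (INR n)
    <= Rmax (a2 + 3 * d / 4) (y 0 - INR n * step).
Proof.
induction n as [|n IH].
- change (INR 0) with 0; rewrite !Rmult_0_l, Rplus_0_r, Rminus_0_r.
  split; [apply Rmin_r|apply Rmax_r].
- assert (Htube := samples_in_tube n IH); assert (Hn := pos_INR n).
  rewrite S_INR.
  assert (X := period_excursion n (d / 4) Htube gamma_small (INR n + 1) ltac:(lra)).
  assert (Y := period_increment n (d / 4) Htube gamma_small).
  assert (E : gamma * (L * (gamma * M)) <= step).
  { unfold step; apply Rle_trans with (gamma * (c / 4)); [|right; field].
    apply Rmult_le_compat_l; lra. }
  apply Rabs_le_between in X; apply Rabs_le_between in Y.
  set (z := y (INR n)) in *.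
  split.
  + destruct (Rle_lt_dec z (a1 - d / 2)) as [Hz|Hz].
    * assert (G := Rmult_le_compat_l (gamma / 2) _ _ ltac:(lra) (push_right z Hz)).
      assert (z + step <= y (INR n + 1)) by (unfold step in *; lra).
      assert (P : 0 <= step) by (unfold step; nra).
      destruct IH as [IH _]; revert IH; unfold Rmin.
      destruct (Rle_dec (a1 - 3 * d / 4) (y 0 + INR n * step)),
        (Rle_dec (a1 - 3 * d / 4) (y 0 + (INR n + 1) * step)); lra.
    * eapply Rle_trans; [apply Rmin_l|]; lra.
  + destruct (Rle_lt_dec (a2 + d / 2) z) as [Hz|Hz].
    * assert (G := Rmult_le_compat_l (gamma / 2) _ _ ltac:(lra) (push_left z Hz)).
      assert (y (INR n + 1) <= z - step) by (unfold step in *; lra).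
      assert (P : 0 <= step) by (unfold step; nra).
      destruct IH as [_ IH]; revert IH; unfold Rmax.
      destruct (Rle_dec (a2 + 3 * d / 4) (y 0 - INR n * step)),
        (Rle_dec (a2 + 3 * d / 4) (y 0 - (INR n + 1) * step)); lra.
    * eapply Rle_trans; [|apply Rmax_l]; lra.
Qed.

Lemma stays_in_tube t : 0 <= t -> Rabs (y t - xstar) <= r - delta.
Proof.
intros Ht; destruct (nfloor_ex t Ht) as [n Hn].
assert (Htube := samples_in_tube n (samples_bound n)).
assert (X := period_excursion n (d / 4) Htube gamma_small t ltac:(lra)).
apply Rabs_le_between in X; apply Rabs_le_between in Htube; apply Rabs_le_between; lra.
Qed.

(** The distance to travel is at most [r0 + delta], since [a1] and [a2] are within [delta] of
    [xstar]; dividing by [step] gives the number of periods, and the extra 1 pays for rounding [t]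
    down to a sample. *)
Lemma eventually_near r0 t :
  Rabs (y 0 - xstar) <= r0 -> 4 * (r0 + delta) / (gamma * c) + 1 <= t ->
  a1 - d <= y t <= a2 + d.
Proof.
intros Hr0 Ht; assert (Hgc : 0 < gamma * c) by (apply Rmult_lt_0_compat; lra).
assert (Hr0' := Rle_trans _ _ _ (Rabs_pos _) Hr0).
assert (Htpos : 0 <= t).
{ apply Rle_trans with (2 := Ht).
  assert (0 <= 4 * (r0 + delta) / (gamma * c)) by (apply Rdiv_le_0_compat; lra); lra. }
destruct (nfloor_ex t Htpos) as [n Hn].
assert (Hfar : r0 + delta <= INR n * step).
{ replace (r0 + delta) with (4 * (r0 + delta) / (gamma * c) * step)
    by (unfold step; field; lra).
  apply Rmult_le_compat_r; unfold step; lra. }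
assert (B := samples_bound n); assert (Htube := samples_in_tube n B).
assert (X := period_excursion n (d / 4) Htube gamma_small t ltac:(lra)).
apply Rabs_le_between in X; apply Rabs_le_between in Hr0.
revert B; unfold Rmin, Rmax.
destruct (Rle_dec (a1 - 3 * d / 4) (y 0 + INR n * step)),
  (Rle_dec (a2 + 3 * d / 4) (y 0 - INR n * step)); lra.
Qed.

End Convergence.

End Sampling.

(** * Existence and conclusion *)

Definition clip (lo hi x : R) : R := Rmax lo (Rmin hi x).

Lemma clip_range lo hi x : lo <= hi -> lo <= clip lo hi x <= hi.
Proof. intros H; unfold clip, Rmax, Rmin; repeat destruct Rle_dec; lra. Qed.

Lemma clip_id lo hi x : lo <= x <= hi -> clip lo hi x = x.
Proof. intros H; unfold clip, Rmax, Rmin; repeat destruct Rle_dec; lra. Qed.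

Lemma clip_Lipschitz lo hi x y : Rabs (clip lo hi x - clip lo hi y) <= Rabs (x - y).
Proof.
unfold clip, Rmax, Rmin; repeat destruct Rle_dec; unfold Rabs;
  repeat destruct Rcase_abs; lra.
Qed.

Lemma dist_clip_le lo hi x d :
  lo <= hi -> 0 <= d -> lo - d <= x <= hi + d -> Rabs (x - clip lo hi x) <= d.
Proof.
intros H Hd Hx; apply Rabs_le_between.
unfold clip, Rmax, Rmin; repeat destruct Rle_dec; lra.
Qed.

(** Clipping the state to the tube keeps the argument of [h] where its bounds hold, so the field
    becomes globally bounded and Lipschitz. *)
Lemma clipped_solution (h : R -> R) (delta gamma xstar r M L x0 : R) :
  (forall x, continuous h x) -> 0 < gamma -> 0 < L -> delta <= r ->
  0 < delta ->
  (forall x, xstar - r <= x <= xstar + r -> Rabs (h x) <= M) ->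
  (forall x1 x2,
     xstar - r <= x1 <= xstar + r -> xstar - r <= x2 <= xstar + r ->
     Rabs (h x1 - h x2) <= L * Rabs (x1 - x2)) ->
  exists X, X 0 = x0 /\ forall t, 0 <= t -> is_derive X t
    (dither_field h delta gamma t
       (clip (xstar - (r - delta)) (xstar + (r - delta)) (X t))).
Proof.
intros Ch Hgamma HL Hr Hdelta HM HLip.
set (k := clip (xstar - (r - delta)) (xstar + (r - delta))).
assert (Hk : forall x, Rabs (k x - xstar) <= r - delta).
{ intros x; assert (C := clip_range (xstar - (r - delta)) (xstar + (r - delta)) x ltac:(lra)).
  fold (k x) in C; apply Rabs_le_between; lra. }
apply (picard (fun t x => dither_field h delta gamma t (k x)) (gamma * M) (gamma * L)).
- nra.
- intros X CX t; unfold dither_field.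
  apply continuous_mult_dither.
  apply (continuous_scal_r (- gamma) (fun s => h (k (X s) + delta * dither s))).
  apply (continuous_comp (fun s => k (X s) + delta * dither s) h); [|apply Ch].
  apply (continuous_plus (fun s => k (X s)) (fun s => delta * dither s)).
  + apply (continuous_comp X k); [apply CX|].
    apply Lipschitz_continuous with 1; [lra|]; intros; rewrite Rmult_1_l.
    apply clip_Lipschitz.
  + apply (continuous_scal_r delta dither), dither_continuous.
- intros t x; apply (dither_field_bounded h delta gamma xstar r M); try easy.
- intros t x1 x2; unfold dither_field.
  replace (- gamma * h (k x1 + delta * dither t) * dither t
           - - gamma * h (k x2 + delta * dither t) * dither t)
    with (gamma * ((h (k x2 + delta * dither t) - h (k x1 + delta * dither t)) * dither t))
    by ring.
  rewrite !Rabs_mult, (Rabs_pos_eq gamma), Rmult_assoc by lra.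
  apply Rmult_le_compat_l; [lra|].
  assert (A := HLip _ _ (dithered_range delta xstar r Hdelta (k x2) t (Hk x2))
                        (dithered_range delta xstar r Hdelta (k x1) t (Hk x1))).
  replace (k x2 + delta * dither t - (k x1 + delta * dither t))
    with (- (k x1 - k x2)) in A by ring.
  rewrite Rabs_Ropp in A.
  assert (B := clip_Lipschitz (xstar - (r - delta)) (xstar + (r - delta)) x1 x2).
  fold (k x1) in B; fold (k x2) in B.
  assert (U := dither_bound t); assert (V := Rabs_pos (dither t)).
  assert (W := Rabs_pos (h (k x2 + delta * dither t) - h (k x1 + delta * dither t))).
  assert (L * Rabs (k x1 - k x2) <= L * Rabs (x1 - x2)) by (apply Rmult_le_compat_l; lra).
  nra.
Qed.

Theorem proposition1 :
  forall (delta : R) (b : R -> R) (Adelta : R -> Prop)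
         (beta : R -> R -> R) (chi : R -> R),
    0 < delta ->
    compact Adelta ->
    (exists a, Adelta a) ->
    (forall gamma, 0 < gamma ->
       globally_asymptotically_stable (average_field b gamma) Adelta /\
       locally_exponentially_stable (average_field b gamma) Adelta) ->
    class_KL beta ->
    (forall gamma xa, 0 < gamma -> solution (average_field b gamma) xa ->
       forall t, 0 <= t ->
         dist_set Adelta (xa t) <= beta (dist_set Adelta (xa 0)) (gamma * t)) ->
    class_Kinfty (fun s => beta s 0) ->
    class_Kinfty chi ->
    inverse_on_nonneg (fun s => beta s 0) chi ->
    exists (tbar : R -> R -> R) (gamma_star : R -> R -> R -> R -> R),
      forall (h : R -> R) (xstar : R) (m alpha : R -> R) (A : R),
        assumption1 h xstar ->
        assumption2 h xstar m alpha A ->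
        (forall x, b x = b1 h delta x) ->
        (forall a, Adelta a -> xstar - delta <= a <= xstar + delta) ->
        forall r d bbar : R,
          0 < r -> 0 < d -> r - d - 2 * delta > 0 ->
          0 < bbar -> delta_lower alpha delta >= A + bbar ->
          forall Mr Lr : R,
            0 < Mr -> 0 < Lr ->
            (forall x, xstar - r <= x <= xstar + r -> Rabs (h x) <= Mr) ->
            (forall x1 x2, xstar - r <= x1 <= xstar + r ->
               xstar - r <= x2 <= xstar + r ->
               Rabs (h x1 - h x2) <= Lr * Rabs (x1 - x2)) ->
            let r0 := chi (r - d - 2 * delta) in
            0 < gamma_star Mr Lr delta d /\
            forall gamma, 0 < gamma < gamma_star Mr Lr delta d ->
            forall x0, Rabs (x0 - xstar) <= r0 ->
              (exists x, x 0 = x0 /\ solution (dither_field h delta gamma) x) /\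
              (forall x, x 0 = x0 -> solution (dither_field h delta gamma) x ->
                 (exists B, forall t, 0 <= t -> Rabs (x t) <= B) /\
                 (forall t, 0 <= t -> t >= tbar r0 d / gamma ->
                    dist_set Adelta (x t) <= d)).
Proof.
intros delta b S beta chi Hdelta _ Sne Hstab _ Hbeta _ _ Hchi.
assert (Hgas := proj1 (Hstab 1 Rlt_0_1)).
pose (pushes := fun a1 a2 d c => 0 < c /\
  forall x, (a2 + d <= x -> c <= b x) /\ (x <= a1 - d -> b x <= - c)).
pose (interval := fun a1 a2 => is_lub S a2 /\ is_lub (fun y => S (- y)) (- a1) /\
  (forall x, a1 <= x <= a2 -> dist_set S x = 0) /\
  forall d, 0 < d -> exists c, pushes a1 a2 d c).
(* [gamma_star] and [tbar] may not depend on [h], so the endpoints of the attractor and the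
   strength [C] of the averaged drift are chosen from [b] and [S] alone; their existence
   follows from any admissible [h]. *)
assert (Hinterval : forall h xstar m alpha A r bbar Lr,
  assumption1 h xstar -> assumption2 h xstar m alpha A ->
  (forall x, b x = b1 h delta x) ->
  (forall a, S a -> xstar - delta <= a <= xstar + delta) ->
  2 * delta < r -> 0 < bbar -> delta_lower alpha delta >= A + bbar ->
  (forall x1 x2, xstar - r <= x1 <= xstar + r -> xstar - r <= x2 <= xstar + r ->
     Rabs (h x1 - h x2) <= Lr * Rabs (x1 - x2)) ->
  exists a1 a2, interval a1 a2).
{ intros h xstar m alpha A r bbar Lr H1 H2 Hb HS Hr Hbbar Hlow HLip.
  assert (Ch : forall x, continuous h x) by (intros; apply smooth_continuous, H1).
  apply (attractor_interval b S Sne Hgas (xstar - delta) (xstar + delta)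
           (4 * bbar * RInt dither 0 (1 / 2))).
  - exact HS.
  - apply Rmult_lt_0_compat; [lra|apply dither_half_integral_pos].
  - intros x Hx; rewrite Hb; now apply (b1_right h m alpha xstar A).
  - intros x Hx; rewrite Hb; now apply (b1_left h m alpha xstar A).
  - intros x Hx; apply continuity_pt_filterlim, filterlim_locally; intros eps.
    assert (He := cond_pos eps).
    assert (Hq : 0 < eps / (2 * Rabs Lr + 1)).
    { apply Rdiv_lt_0_compat; [lra|]; assert (P := Rabs_pos Lr); lra. }
    assert (Hm : 0 < Rmin (r - 2 * delta) (eps / (2 * Rabs Lr + 1)))
      by (apply Rmin_pos; lra).
    exists (mkposreal _ Hm); intros z Hz.
    change (Rabs (z - x) < Rmin (r - 2 * delta) (eps / (2 * Rabs Lr + 1))) in Hz.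
    change (Rabs (b z - b x) < eps); rewrite !Hb.
    assert (U := Rmin_l (r - 2 * delta) (eps / (2 * Rabs Lr + 1))).
    assert (V := Rmin_r (r - 2 * delta) (eps / (2 * Rabs Lr + 1))).
    assert (P := Rabs_pos Lr); assert (Q := Rabs_pos (z - x)).
    apply Rle_lt_trans with (2 * (Rabs Lr * Rabs (z - x))).
    + apply b1_Lipschitz; [exact Hdelta|exact Ch|]; intros t.
      apply Rle_trans with (Lr * Rabs (z - x)).
      * replace (z - x) with (z + delta * dither t - (x + delta * dither t)) by ring.
        assert (Hz' : Rabs (z - x) < r - 2 * delta) by lra; apply Rabs_def2 in Hz'.
        apply HLip; apply dithered_range; try easy; apply Rabs_le_between; lra.
      * apply Rmult_le_compat_r; [exact Q|apply RRle_abs].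
    + assert (Rabs (z - x) * (2 * Rabs Lr + 1) < eps); [|nra].
      replace (pos eps) with (eps / (2 * Rabs Lr + 1) * (2 * Rabs Lr + 1)) by (field; lra).
      apply Rmult_lt_compat_r; lra. }
destruct (classic (exists a1 a2, interval a1 a2)) as [(a1 & a2 & lub2 & lub1 & Hzero & Hpush)|Hnone].
(* Without such an interval no admissible data exist, and any values will do. *)
2:{ exists (fun _ _ => 0), (fun _ _ _ _ => 0).
    intros h xstar m alpha A H1 H2 Hb HS r d bbar Hr Hd Hrd Hbbar Hlow M L HM HL HMr HLr.
    exfalso; apply Hnone; apply (Hinterval h xstar m alpha A r bbar L); try easy; lra. }
pose (C := fun d => epsilon (inhabits 0) (pushes a1 a2 d)).
assert (HC : forall d, 0 < d -> pushes a1 a2 d (C d)).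
{ intros d Hd; apply epsilon_spec, Hpush, Hd. }
(* The time of [eventually_near], with [gamma] taken out. The bound [gamma < 1] turns its isolated 1
   into at most [1 / gamma]; the two other bounds give [gamma * M < d / 4] and
   [gamma * (L * M) <= c / 4]. *)
exists (fun r0 d => 4 * (r0 + delta) / C (d / 2) + 1),
  (fun M L _ d => Rmin 1 (Rmin (d / (4 * M)) (C (d / 2) / (4 * (L * M))))).
intros h xstar m alpha A H1 H2 Hb HS r d bbar Hr Hd Hrd Hbbar Hlow M L HM HL HMr HLr r0.
assert (Ch : forall x, continuous h x) by (intros; apply smooth_continuous, H1).
destruct (HC (d / 2) ltac:(lra)) as [Hc HcPush].
set (c := C (d / 2)) in *.
assert (HLM : 0 < L * M) by (apply Rmult_lt_0_compat; lra).
split.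
{ apply Rmin_pos; [lra|]; apply Rmin_pos; apply Rdiv_lt_0_compat; lra. }
intros gamma [Hgamma Hsmall] x0 Hx0.
assert (Ha : xstar - delta <= a1 /\ a1 <= a2 /\ a2 <= xstar + delta).
{ destruct Sne as [a Sa].
  assert (a <= a2) by (now apply lub2).
  assert (- a <= - a1) by (apply lub1; now rewrite Ropp_involutive).
  assert (a2 <= xstar + delta) by (apply lub2; intros y Sy; apply HS in Sy; lra).
  assert (- a1 <= - xstar + delta) by (apply lub1; intros y Sy; apply HS in Sy; lra).
  lra. }
(* The stability estimate at time 0, for a solution started at distance exactly [r0], reads
   [r0 <= beta r0 0], and the right-hand side is [r - d - 2 * delta] by the choice of [chi]. *)
assert (Hr0 : r0 <= r - d - 2 * delta).
{ destruct (Hchi (r - d - 2 * delta) ltac:(lra)) as (Hpos & Hinv & _).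
  fold r0 in Hpos, Hinv; cbv beta in Hinv.
  assert (Hdist : dist_set S (a2 + r0) = r0).
  { apply Rle_antisym.
    - assert (T := dist_set_triangle S Sne (a2 + r0) a2).
      rewrite (Hzero a2), Rplus_minus_l, Rabs_pos_eq in T by lra; lra.
    - apply dist_set_lower_bound; [exact Sne|]; intros a Sa.
      apply Rle_trans with (2 := RRle_abs _); assert (a <= a2) by now apply lub2.
      lra. }
  destruct (proj1 Hgas (a2 + r0)) as (xa & Hxa & Hsol).
  assert (B := Hbeta 1 xa Rlt_0_1 Hsol 0 (Rle_refl 0)).
  rewrite Hxa, Hdist, Rmult_0_r, Hinv in B; lra. }
assert (HgM : gamma * M < d / 4).
{ assert (Q : gamma < d / (4 * M)).
  { eapply Rlt_le_trans; [exact Hsmall|].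
    eapply Rle_trans; [apply Rmin_r|apply Rmin_l]. }
  apply (Rmult_lt_compat_r M) in Q; [|lra].
  replace (d / (4 * M) * M) with (d / 4) in Q by (field; lra); lra. }
assert (HgLM : gamma * (L * M) <= c / 4).
{ assert (Q : gamma < c / (4 * (L * M))).
  { eapply Rlt_le_trans; [exact Hsmall|].
    eapply Rle_trans; [apply Rmin_r|apply Rmin_r]. }
  apply (Rmult_lt_compat_r (L * M)) in Q; [|lra].
  replace (c / (4 * (L * M)) * (L * M)) with (c / 4) in Q by (field; lra); lra. }
assert (Hg1 : gamma < 1) by (eapply Rlt_le_trans; [exact Hsmall|apply Rmin_l]).
assert (Hright : forall x, a2 + d / 2 <= x -> c <= b1 h delta x).
{ intros x Hx; rewrite <- Hb; now apply HcPush. }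
assert (Hleft : forall x, x <= a1 - d / 2 -> b1 h delta x <= - c).
{ intros x Hx; rewrite <- Hb; now apply HcPush. }
assert (Htube : forall y, (forall t, continuous y t) -> y 0 = x0 ->
  (forall t, 0 < t -> Rabs (y t - xstar) <= r - delta ->
     is_derive y t (dither_field h delta gamma t (y t))) ->
  forall t, 0 <= t -> Rabs (y t - xstar) <= r - delta).
{ intros y Cy Hy0 Dy.
  apply (stays_in_tube h delta gamma xstar r M L y) with (a1 := a1) (a2 := a2) (c := c) (d := d);
    try easy; try lra; rewrite Hy0; lra. }
split.
- destruct (clipped_solution h delta gamma xstar r M L x0) as (X & HX0 & HX); try easy; try lra.
  exists X; split; [exact HX0|].
  set (k := clip (xstar - (r - delta)) (xstar + (r - delta))) in HX.
  assert (Hsol : solution (fun t x => dither_field h delta gamma t (k x)) X)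
    by now apply solution_of_derive.
  assert (Hk : forall x, Rabs (x - xstar) <= r - delta -> k x = x).
  { intros x Hx; apply Rabs_le_between in Hx; apply clip_id; lra. }
  (* The tube bound makes the clip the identity along [X], which therefore solves the original
     equation. *)
  apply solution_of_derive; intros t Ht.
  rewrite <- (Hk (X t)) at 1; [now apply HX|].
  rewrite <- (Rmax_right 0 t) by assumption.
  apply (Htube (fun t => X (Rmax 0 t))); [|now rewrite Rmax_left by lra| |exact Ht].
  + intros s; exact (solution_continuous _ X Hsol s).
  + intros s Hs HXs; rewrite <- (Hk _ HXs), (Rmax_right 0 s) by lra.
    exact (solution_derive _ X Hsol s Hs).
- intros x Hx Hsol.
  pose (y := fun t => x (Rmax 0 t)).
  assert (Hy : forall t, 0 <= t -> y t = x t).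
  { intros t Ht; unfold y; now rewrite Rmax_right. }
  assert (Cy : forall t, continuous y t) by (intros t; exact (solution_continuous _ x Hsol t)).
  assert (Hy0 : y 0 = x0) by (rewrite Hy; [exact Hx|lra]).
  assert (Dy : forall t, 0 < t -> Rabs (y t - xstar) <= r - delta ->
     is_derive y t (dither_field h delta gamma t (y t))).
  { intros t Ht _; rewrite Hy at 1 by lra; exact (solution_derive _ x Hsol t Ht). }
  split.
  + exists (Rabs xstar + (r - delta)); intros t Ht.
    assert (B := Htube y Cy Hy0 Dy t Ht); rewrite Hy in B by exact Ht.
    assert (T := Rabs_triang (x t - xstar) xstar).
    replace (x t - xstar + xstar) with (x t) in T by ring; lra.
  + intros t Ht Hlate.
    assert (Hend : a1 - d <= y t <= a2 + d).
    { apply (eventually_near h delta gamma xstar r M L y) with (c := c) (r0 := r0);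
        try easy; try lra; try (rewrite Hy0; lra).
      apply Rle_trans with (2 := Rge_le _ _ Hlate).
      replace (4 * (r0 + delta) / (gamma * c)) with (4 * (r0 + delta) / c / gamma)
        by (field; lra).
      assert (1 <= / gamma) by (rewrite <- Rinv_1; apply Rinv_le_contravar; lra).
      unfold Rdiv at 3; rewrite Rmult_plus_distr_r; fold (4 * (r0 + delta) / c / gamma); lra. }
    rewrite Hy in Hend by exact Ht.
    (* The clip is the nearest point of the interval, itself at distance 0 from [S]. *)
    assert (T := dist_set_triangle S Sne (x t) (clip a1 a2 (x t))).
    rewrite (Hzero (clip _ _ _)) in T by (apply clip_range; lra).
    assert (Q := dist_clip_le a1 a2 (x t) d ltac:(lra) ltac:(lra) Hend); lra.
Qed.
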